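(* Let $M$ be an oriented complete Riemannian manifold with $\dim(M)=3$, $\nu>0$, and let $u_t$ be a smooth solution of the Navier-Stokes equation $$\partial_tu_t+\nabla_{u_t}u_t+\nu\,\square u_t=-\nabla p_t,\qquad\mathrm{div}(u_t)=0 .$$ Let $\tilde\omega_t=d\tilde u_t$ and $\omega_t=*\tilde\omega_t$. Then $$\partial_t\omega_t+\nabla_{u_t}\omega_t+\nu\,\square\omega_t=\omega_t\triangleleft(\nabla^su_t).$$
   Context: $\nabla$ is the Levi-Civita connection; $\tilde u$ is the $1$-form metrically dual to the vector field $u$; $\square=dd^*+d^*d$ on forms, and $\square u$ is the vector field dual to $\square\tilde u$; $*$ is the Hodge star, $\beta\wedge*\alpha=\langle\beta,\alpha\rangle\,\omega_{\mathrm{vol}}$ with $\omega_{\mathrm{vol}}$ the Riemannian volume form. $\nabla^su$ is the symmetric part of $\nabla u$: $\langle\nabla^s_Xu,Y\rangle=\frac12(\langle\nabla_Xu,Y\rangle+\langle\nabla_Yu,X\rangle)$. For a $1$-form $\omega$, $(\omega\triangleleft\nabla^su)(X)=\omega(\nabla^s_Xu)$. *)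

(* Defs.v *)
From mathcomp Require Import all_boot all_order all_algebra.
From mathcomp Require Import all_classical all_reals all_analysis.
From mathcomp Require Import ring.

Set Implicit Arguments.
Unset Strict Implicit.
Unset Printing Implicit Defensive.

Import Order.TTheory GRing.Theory Num.Theory.
Import numFieldNormedType.Exports.
Local Open Scope classical_set_scope.
Local Open Scope ring_scope.

(* A tensor field on a manifold is represented by its components in every     *)
(* chart, subject to the usual transformation law.  The coordinate expression *)
(* of a field is a function of x : 'rV[R]_n and, for vector fields and        *)
(* p-forms, of tensor indices in 'I_n; p-forms are antisymmetric in their     *)
(* indices, alpha_{i j} standing for alpha(d/dx^i, d/dx^j).  Only the values  *)
(* at points x of the image of the chart are meaningful.                      *)

Section Smoothness.
Variables (R : realType) (n : nat).
Implicit Types (U : set 'rV[R]_n) (J : set R).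

Definition basis_vec (i : 'I_n) : 'rV[R]_n := delta_mx 0 i.

Definition partial (i : 'I_n) (f : 'rV[R]_n -> R) (x : 'rV[R]_n) : R :=
  'D_(basis_vec i) f x.

Fixpoint class_C (k : nat) U (f : 'rV[R]_n -> R) : Prop :=
  {within U, continuous f} /\
  if k is k'.+1 then
    forall i, (forall x, U x -> derivable f x (basis_vec i)) /\
              class_C k' U (partial i f)
  else True.

Definition smooth_on U (f : 'rV[R]_n -> R) := forall k, class_C k U f.

(* The time derivative is taken within J, hence is one-sided at an end point  *)
(* of J that belongs to J.                                                    *)
Definition dt_quotient J (f : R -> R) (t h : R) : R := h^-1 * (f (h + t) - f t).

Definition dt_derivable J (f : R -> R) (t : R) : Prop :=
  cvg (dt_quotient J f t @ within [set h | J (h + t)] 0^').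

Definition dt J (f : R -> R) (t : R) : R :=
  lim (dt_quotient J f t @ within [set h | J (h + t)] 0^').

Lemma dt_interior J (f : R -> R) (t : R) : nbhs t J -> dt J f t = derive1 f t.
Proof.
move=> Jt; rewrite /dt /derive1 (_ : within _ _ = 0^')//.
have Jh : \forall h \near 0^', J (h + t).
  apply: nbhs_dnbhs; move: Jt; rewrite -[X in nbhs X _](add0r t) => Jt.
  have : (fun h : R => h + t) @ nbhs 0 --> (0 + t : R).
    by apply: cvgD; [exact: cvg_id|exact: cvg_cst].
  exact.
rewrite eqEsubset; split => A; rewrite /within/= => h.
  by apply: filterS2 h Jh => y; exact.
by near=> y => _; near: y.
Unshelve. all: by end_near.
Qed.

Fixpoint time_class_C (k : nat) J U (F : R -> 'rV[R]_n -> R) : Prop :=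
  {within J `*` U, continuous (fun z : R * 'rV[R]_n => F z.1 z.2)} /\
  if k is k'.+1 then
    [/\ forall t x, J t -> U x -> dt_derivable J (F ^~ x) t,
        time_class_C k' J U (fun t x => dt J (F ^~ x) t) &
        forall i,
          (forall t x, J t -> U x -> derivable (F t) x (basis_vec i)) /\
          time_class_C k' J U (fun t => partial i (F t))]
  else True.

Definition time_smooth_on J U (F : R -> 'rV[R]_n -> R) :=
  forall k, time_class_C k J U F.

End Smoothness.

Section OrientedManifold.
Variables (R : realType) (n : nat).

(* A smooth manifold without boundary, given by an oriented smooth atlas.     *)
Record oriented_manifold := OrientedManifold {
  carrier :> topologicalType ;
  carrier_hausdorff : hausdorff_space carrier ;
  carrier_second_countable : @second_countable carrier ;
  atlas : Type ;
  chart_dom : atlas -> set carrier ;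
  chart : atlas -> carrier -> 'rV[R]_n ;
  chart_inv : atlas -> 'rV[R]_n -> carrier ;
  chart_dom_open : forall c, open (chart_dom c) ;
  chart_dom_cover : forall p, exists c, chart_dom c p ;
  chart_image_open : forall c, open (chart c @` chart_dom c) ;
  chartK : forall c p, chart_dom c p -> chart_inv c (chart c p) = p ;
  chart_continuous : forall c, {within chart_dom c, continuous (chart c)} ;
  chart_inv_continuous : forall c,
    {within chart c @` chart_dom c, continuous (chart_inv c)} ;
  transition_smooth : forall c d (k : 'I_n),
    smooth_on (chart c @` (chart_dom c `&` chart_dom d))
              (fun x => chart d (chart_inv c x) 0 k) ;
  transition_oriented : forall c d x,
    (chart c @` (chart_dom c `&` chart_dom d)) x ->
    0 < \det (\matrix_(k < n, i < n)
               partial i (fun y => chart d (chart_inv c y) 0 k) x) }.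

Variable M : oriented_manifold.

Definition chart_image (c : atlas M) : set 'rV[R]_n := chart c @` chart_dom c.

Definition chart_overlap (c d : atlas M) : set 'rV[R]_n :=
  chart c @` (chart_dom c `&` chart_dom d).

Definition transition (c d : atlas M) (x : 'rV[R]_n) : 'rV[R]_n :=
  chart d (chart_inv c x).

Definition jacobian (c d : atlas M) (x : 'rV[R]_n) : 'M[R]_n :=
  \matrix_(k < n, i < n) partial i (fun y => transition c d y 0 k) x.

Record riemannian_metric := RiemannianMetric {
  metric :> atlas M -> 'rV[R]_n -> 'M[R]_n ;
  metric_smooth : forall c i j,
    smooth_on (chart_image c) (fun x => metric c x i j) ;
  metric_sym : forall c x, chart_image c x -> (metric c x)^T = metric c x ;
  metric_pos : forall c x (v : 'rV[R]_n), chart_image c x -> v != 0 ->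
    0 < (v *m metric c x *m v^T) 0 0 ;
  metric_transition : forall c d x, chart_overlap c d x ->
    metric c x =
    (jacobian c d x)^T *m metric d (transition c d x) *m jacobian c d x }.

Definition is_vector_field (u : atlas M -> 'rV[R]_n -> 'I_n -> R) : Prop :=
  forall c d x, chart_overlap c d x -> forall k,
    u d (transition c d x) k = \sum_(i < n) jacobian c d x k i * u c x i.

Definition smooth_function (f : M -> R) : Prop :=
  forall c, smooth_on (chart_image c) (f \o chart_inv c).

Definition time_smooth_vector_field (J : set R)
    (u : R -> atlas M -> 'rV[R]_n -> 'I_n -> R) : Prop :=
  (forall t, J t -> is_vector_field (u t)) /\
  forall c k, time_smooth_on J (chart_image c) (fun t x => u t c x k).

End OrientedManifold.

(* Coordinate expressions of the Levi-Civita calculus of the metric           *)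
(* g_{i j} dx^i dx^j.                                                         *)
Section LeviCivita.
Variables (R : realType) (n : nat) (g : 'rV[R]_n -> 'M[R]_n).
Implicit Types (x : 'rV[R]_n) (f : 'rV[R]_n -> R).
Implicit Types u v omega : 'rV[R]_n -> 'I_n -> R.

Definition ginv x : 'M[R]_n := invmx (g x).

Definition inner x (X Y : 'I_n -> R) : R :=
  \sum_(i < n) \sum_(j < n) g x i j * X i * Y j.

Definition flat u x (i : 'I_n) : R := \sum_(j < n) g x i j * u x j.

Definition sharp omega x (i : 'I_n) : R := \sum_(j < n) ginv x i j * omega x j.

Definition gradient f x (i : 'I_n) : R :=
  \sum_(j < n) ginv x i j * partial j f x.

(* Gamma^k_{i j}; see levi_civitaP for its characterization as the unique     *)
(* torsion-free metric connection.                                            *)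
Definition christoffel x (k i j : 'I_n) : R :=
  2^-1 * \sum_(l < n) ginv x k l *
    (partial i (fun y => g y j l) x + partial j (fun y => g y i l) x
     - partial l (fun y => g y i j) x).

(* The k-th component of nabla_{d/dx^i} u.                                    *)
Definition covd u x (i k : 'I_n) : R :=
  partial i (fun y => u y k) x + \sum_(j < n) christoffel x k i j * u x j.

Definition nabla u v x (k : 'I_n) : R := \sum_(i < n) u x i * covd v x i k.

(* (nabla_{d/dx^i} omega)(d/dx^j), for a 1-form omega.                        *)
Definition covd_form omega x (i j : 'I_n) : R :=
  partial i (fun y => omega y j) x
  - \sum_(k < n) christoffel x k i j * omega x k.

Definition nabla_form u omega x (j : 'I_n) : R :=
  \sum_(i < n) u x i * covd_form omega x i j.

(* div u is the trace of X |-> nabla_X u.                                     *)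
Definition divergence u x : R := \sum_(i < n) covd u x i i.

(* The k-th component of nabla^s_{d/dx^i} u; see nabla_symP.                  *)
Definition nabla_sym u x (i k : 'I_n) : R :=
  \sum_(j < n) ginv x k j *
    (2^-1 * \sum_(l < n) (covd u x i l * g x l j + covd u x j l * g x l i)).

(* (omega <| A)(X) = omega (A X), where A (d/dx^i) has components A i k.      *)
Definition comp_form omega (A : 'rV[R]_n -> 'I_n -> 'I_n -> R) x (i : 'I_n) : R :=
  \sum_(k < n) omega x k * A x i k.

Lemma ginvVr x : g x \in unitmx ->
  forall i j, \sum_(l < n) g x i l * ginv x l j = (i == j)%:R.
Proof.
by move=> gu i j; have /matrixP/(_ i j) := mulmxV gu; rewrite !mxE.
Qed.

Lemma ginvVl x : g x \in unitmx ->
  forall i j, \sum_(l < n) ginv x i l * g x l j = (i == j)%:R.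
Proof.
by move=> gu i j; have /matrixP/(_ i j) := mulVmx gu; rewrite !mxE.
Qed.

Let sum_delta (F : 'I_n -> R) i : \sum_(j < n) (j == i)%:R * F j = F i.
Proof.
rewrite (bigD1 i)//= eqxx mul1r big1 ?addr0// => j /negPf ->.
by rewrite mul0r.
Qed.

Let lower_raise x (F : 'I_n -> R) i : g x \in unitmx ->
  \sum_(k < n) (\sum_(l < n) ginv x k l * F l) * g x i k = F i.
Proof.
move=> gu; under eq_bigr do rewrite mulr_suml.
rewrite exchange_big/= -[RHS]sum_delta; apply: eq_bigr => l _.
rewrite eq_sym -(ginvVr gu i l) mulr_suml; apply: eq_bigr => k _; ring.
Qed.

Let raise_inj x (F G : 'I_n -> R) : g x \in unitmx ->
  (forall i, \sum_(k < n) F k * g x i k = \sum_(k < n) G k * g x i k) ->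
  F =1 G.
Proof.
move=> gu FG i.
have H (E : 'I_n -> R) :
  \sum_(j < n) ginv x i j * (\sum_(k < n) E k * g x j k) = E i.
  under eq_bigr do rewrite mulr_sumr.
  rewrite exchange_big/= -[RHS]sum_delta; apply: eq_bigr => k _.
  rewrite eq_sym -(ginvVl gu i k) mulr_suml; apply: eq_bigr => j _; ring.
by rewrite -[LHS]H -[RHS]H; apply: eq_bigr => j _; rewrite FG.
Qed.

Lemma levi_civitaP x (G : 'I_n -> 'I_n -> 'I_n -> R) :
  g x \in unitmx -> (\forall y \near x, (g y)^T = g y) ->
  (forall k i j, G k i j = christoffel x k i j) <->
  (forall k i j, G k i j = G k j i) /\
  (forall i j k, partial k (fun y => g y i j) x =
     \sum_(l < n) (G l k i * g x l j + G l k j * g x i l)).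
Proof.
move=> gu gs.
have dgs i j k : partial k (fun y => g y i j) x = partial k (fun y => g y j i) x.
  rewrite /partial; apply: near_eq_derive.
  near=> y; have /matrixP/(_ j i) : (g y)^T = g y by near: y.
  by rewrite mxE.
have gsx i j : g x i j = g x j i.
  by have /matrixP/(_ j i) := nbhs_singleton gs; rewrite mxE.
have lowerG i j k : \sum_(l < n) christoffel x l i j * g x k l =
    2^-1 * (partial i (fun y => g y j k) x + partial j (fun y => g y i k) x
     - partial k (fun y => g y i j) x).
  rewrite -[RHS](lower_raise (fun k => 2^-1 * (partial i (fun y => g y j k) x
    + partial j (fun y => g y i k) x - partial k (fun y => g y i j) x)) _ gu).
  apply: eq_bigr => l _; congr (_ * _).
  by rewrite /christoffel mulr_sumr; apply: eq_bigr => m _; ring.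
split=> [GE|[Gs Gm]].
  have Gs k i j : G k i j = G k j i.
    rewrite !GE; congr (_ * _); apply: eq_bigr => l _; congr (_ * _).
    by rewrite (dgs i j l); ring.
  split=> // i j k; rewrite big_split/=.
  have -> : \sum_(l < n) G l k i * g x l j =
            \sum_(l < n) christoffel x l k i * g x j l.
    by apply: eq_bigr => l _; rewrite GE gsx.
  have -> : \sum_(l < n) G l k j * g x i l =
            \sum_(l < n) christoffel x l k j * g x i l.
    by apply: eq_bigr => l _; rewrite GE.
  by rewrite !lowerG (dgs j i k); field.
move=> k i j; move: k; apply: (raise_inj gu) => k; rewrite lowerG !Gm !big_split/=.
have E a b c : \sum_(l < n) G l a b * g x l c = \sum_(l < n) G l b a * g x c l.
  by apply: eq_bigr => l _; rewrite gsx Gs.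
have E' a b c : \sum_(l < n) G l a b * g x c l = \sum_(l < n) G l b a * g x c l.
  by apply: eq_bigr => l _; rewrite Gs.
rewrite !E (E' i k) (E' j k) (E' j i); field.
Unshelve. all: by end_near.
Qed.

Lemma nabla_symP u x (X Y : 'I_n -> R) :
  g x \in unitmx -> (g x)^T = g x ->
  inner x (fun k => \sum_(i < n) X i * nabla_sym u x i k) Y =
  2^-1 * (inner x (fun k => \sum_(i < n) X i * covd u x i k) Y +
          inner x (fun k => \sum_(i < n) Y i * covd u x i k) X).
Proof.
move=> gu /matrixP gs.
have gsx i j : g x i j = g x j i by rewrite -[LHS]gs mxE.
have innerE (A : 'I_n -> 'I_n -> R) (V W : 'I_n -> R) :
    inner x (fun k => \sum_(i < n) V i * A i k) W =
    \sum_(i < n) \sum_(j < n) V i * W j * \sum_(k < n) A i k * g x j k.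
  rewrite /inner exchange_big/= [RHS]exchange_big/=; apply: eq_bigr => j _.
  under eq_bigr do rewrite mulr_sumr mulr_suml.
  rewrite exchange_big/=; apply: eq_bigr => i _.
  by rewrite mulr_sumr; apply: eq_bigr => k _; rewrite (gsx k j); ring.
rewrite !innerE [X in _ + X]exchange_big/= -big_split/= mulr_sumr.
apply: eq_bigr => i _; rewrite -big_split/= mulr_sumr; apply: eq_bigr => j _.
rewrite /nabla_sym (lower_raise (fun j => 2^-1 *
   \sum_(l < n) (covd u x i l * g x l j + covd u x j l * g x l i)) _ gu).
rewrite big_split/=.
have E a b : \sum_(l < n) covd u x a l * g x l b = \sum_(l < n) covd u x a l * g x b l.
  by apply: eq_bigr => l _; rewrite gsx.
by rewrite !E; ring.
Qed.

End LeviCivita.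

Section Hodge.
Variables (R : realType) (g : 'rV[R]_3 -> 'M[R]_3).
Notation form0 := ('rV[R]_3 -> R).
Notation form1 := ('rV[R]_3 -> 'I_3 -> R).
Notation form2 := ('rV[R]_3 -> 'I_3 -> 'I_3 -> R).
Notation form3 := ('rV[R]_3 -> 'I_3 -> 'I_3 -> 'I_3 -> R).

(* The Levi-Civita symbol, a Vandermonde product in the indices.              *)
Definition epsilon (i j k : 'I_3) : R :=
  2^-1 * ((j%:R - i%:R) * (k%:R - i%:R) * (k%:R - j%:R)).

(* Charts being oriented, omega_vol = sqrt (det g) dx^0 /\ dx^1 /\ dx^2.      *)
Definition volume_form : form3 :=
  fun x i j k => Num.sqrt (\det (g x)) * epsilon i j k.

Definition raise2 (a : form2) x i j : R :=
  \sum_(k < 3) \sum_(l < 3) ginv g x i k * ginv g x j l * a x k l.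

Definition raise3 (a : form3) x i j k : R :=
  \sum_(l < 3) \sum_(m < 3) \sum_(p < 3)
    ginv g x i l * ginv g x j m * ginv g x k p * a x l m p.

(* The Hodge star on 1-, 2- and 3-forms,                                      *)
(*   ( *a)_J = 1/p! \sum_I a^I (omega_vol)_{I J};                             *)
(* see star1P, star2P, star3P for b /\ *a = <b, a> omega_vol.                 *)
Definition star1 (a : form1) : form2 := fun x i j =>
  \sum_(k < 3) sharp g a x k * volume_form x k i j.

Definition star2 (a : form2) : form1 := fun x k =>
  2^-1 * \sum_(i < 3) \sum_(j < 3) raise2 a x i j * volume_form x i j k.

Definition star3 (a : form3) : form0 := fun x =>
  6^-1 * \sum_(i < 3) \sum_(j < 3) \sum_(k < 3)
    raise3 a x i j k * volume_form x i j k.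

Definition d0 (f : form0) : form1 := fun x i => partial i f x.

Definition d1 (a : form1) : form2 := fun x i j =>
  partial i (fun y => a y j) x - partial j (fun y => a y i) x.

Definition d2 (a : form2) : form3 := fun x i j k =>
  partial i (fun y => a y j k) x + partial j (fun y => a y k i) x
  + partial k (fun y => a y i j) x.

(* The formal adjoint d^* of d on p-forms is (-1)^(m (p+1) + 1) * d * in      *)
(* dimension m, i.e. (-1)^p * d * for m = 3.                                  *)
Definition codiff1 (a : form1) : form0 := fun x => - star3 (d2 (star1 a)) x.

Definition codiff2 (a : form2) : form1 := star2 (d1 (star2 a)).

Definition box_form (a : form1) : form1 := fun x i =>
  d0 (codiff1 a) x i + codiff2 (d1 a) x i.

Definition box (u : form1) : form1 := sharp g (box_form (flat g u)).

(* Wedge products and inner products of forms, normalized so that             *)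
(* dx^i /\ dx^j and dx^0 /\ dx^1 /\ dx^2 have the usual norms.                *)
Definition wedge12 (b : form1) (a : form2) : form3 := fun x i j k =>
  b x i * a x j k + b x j * a x k i + b x k * a x i j.

Definition wedge21 (b : form2) (a : form1) : form3 := fun x i j k =>
  b x i j * a x k + b x j k * a x i + b x k i * a x j.

Definition inner1 (b a : form1) : form0 := fun x =>
  \sum_(i < 3) b x i * sharp g a x i.

Definition inner2 (b a : form2) : form0 := fun x =>
  2^-1 * \sum_(i < 3) \sum_(j < 3) b x i j * raise2 a x i j.

Definition inner3 (b a : form3) : form0 := fun x =>
  6^-1 * \sum_(i < 3) \sum_(j < 3) \sum_(k < 3) b x i j k * raise3 a x i j k.

Let o0 : 'I_3 := @Ordinal 3 0 isT.
Let o1 : 'I_3 := @Ordinal 3 1 isT.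
Let o2 : 'I_3 := @Ordinal 3 2 isT.

Let sum3 (F : 'I_3 -> R) : \sum_(i < 3) F i = F o0 + F o1 + F o2.
Proof.
rewrite !big_ord_recl big_ord0 addr0 addrA.
by congr (F _ + F _ + F _); exact: val_inj.
Qed.

Let ord3 (P : 'I_3 -> Prop) : P o0 -> P o1 -> P o2 -> forall i, P i.
Proof.
move=> P0 P1 P2 [[|[|[|//]]] h].
- by rewrite (_ : Ordinal h = o0)//; exact: val_inj.
- by rewrite (_ : Ordinal h = o1)//; exact: val_inj.
- by rewrite (_ : Ordinal h = o2)//; exact: val_inj.
Qed.

Lemma star1P (b a : form1) x i j k :
  wedge12 b (star1 a) x i j k = inner1 b a x * volume_form x i j k.
Proof.
rewrite /wedge12 /star1 /inner1 /volume_form /epsilon !sum3.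
by move: i j k; do 3 (apply: ord3); rewrite /=; field.
Qed.

Lemma star2P (b a : form2) x i j k : (forall i j, b x i j = - b x j i) ->
  wedge21 b (star2 a) x i j k = inner2 b a x * volume_form x i j k.
Proof.
move=> bN; have b0 i' : b x i' i' = 0.
  by have /eqP := bN i' i'; rewrite -addr_eq0 -mulr2n mulrn_eq0 => /eqP.
rewrite /wedge21 /star2 /inner2 /volume_form /epsilon !sum3 !b0.
rewrite (bN o1 o0) (bN o2 o0) (bN o2 o1).
move: i j k; do 3 (apply: ord3);
  rewrite ?b0 ?(bN o1 o0) ?(bN o2 o0) ?(bN o2 o1) /=; by field.
Qed.

Lemma star3P (b a : form3) x i j k :
  (forall i j k, b x i j k = - b x j i k) ->
  (forall i j k, b x i j k = - b x i k j) ->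
  b x i j k * star3 a x = inner3 b a x * volume_form x i j k.
Proof.
move=> bN bN'.
have bE i' j' k' : b x i' j' k' = b x o0 o1 o2 * epsilon i' j' k'.
  have z1 p q : b x p p q = 0.
    by have /eqP := bN p p q; rewrite -addr_eq0 -mulr2n mulrn_eq0 => /eqP.
  have z2 p q : b x p q q = 0.
    by have /eqP := bN' p q q; rewrite -addr_eq0 -mulr2n mulrn_eq0 => /eqP.
  have z3 p q : b x p q p = 0 by rewrite bN z2 oppr0.
  rewrite /epsilon; move: i' j' k'; do 3 (apply: ord3);
    rewrite ?z1 ?z2 ?z3 /=; try by field.
  - by rewrite bN'; field.
  - by rewrite bN; field.
  - by rewrite bN' bN; field.
  - by rewrite bN bN'; field.
  - by rewrite bN bN' bN; field.
rewrite bE /inner3 /star3 /volume_form.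
under [in RHS]eq_bigr do under eq_bigr do under eq_bigr do rewrite bE.
set s := Num.sqrt _; set B := b x _ _ _; set e := epsilon i j k.
have -> : 6^-1 * (\sum_(i < 3) \sum_(j < 3) \sum_(k < 3)
    B * epsilon i j k * raise3 a x i j k) * (s * e) = B * e *
   (6^-1 * (s * (\sum_(i < 3) \sum_(j < 3) \sum_(k < 3)
    epsilon i j k * raise3 a x i j k))).
  rewrite (_ : \sum_(i < 3) _ = B * (\sum_(i < 3) \sum_(j < 3) \sum_(k < 3)
    epsilon i j k * raise3 a x i j k)); first by ring.
  by rewrite !sum3; ring.
by congr (_ * (_ * _)); rewrite !sum3; ring.
Qed.

End Hodge.

Section Completeness.
Variables (R : realType) (n : nat) (M : oriented_manifold R n).
Variable g : riemannian_metric M.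

Definition is_geodesic (gamma : R -> M) : Prop :=
  continuous gamma /\
  forall c t, chart_dom c (gamma t) ->
    let q k s := chart c (gamma s) 0 k in
    forall k, [/\ derivable (q k) t 1, derivable (derive1 (q k)) t 1 &
      derive1 (derive1 (q k)) t + \sum_(i < n) \sum_(j < n)
        christoffel (g c) (chart c (gamma t)) k i j
        * derive1 (q i) t * derive1 (q j) t = 0].

Definition geodesically_complete : Prop :=
  forall c p (v : 'I_n -> R), chart_dom c p ->
  exists2 gamma : R -> M, is_geodesic gamma &
    gamma 0 = p /\ forall k, derive1 (fun s => chart c (gamma s) 0 k) 0 = v k.

End Completeness.

(* Main.v *)
Require Import Defs.
From mathcomp Require Import all_boot all_order all_algebra.
From mathcomp Require Import all_classical all_reals all_analysis.
From mathcomp Require Import ring lra.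
Import Order.TTheory GRing.Theory Num.Theory.
Import numFieldNormedType.Exports.
Local Open Scope classical_set_scope.
Local Open Scope ring_scope.

(** Write v^b for the 1-form dual to v, let a = d(u^b) be the vorticity 2-form,
omega = *a the vorticity 1-form, and xi the vector field dual to omega, so that
a = i_xi vol.  The statement is local, so everything happens in the image U of
one chart, where the metric g is a smooth positive definite matrix and
vol = rho dx^0 dx^1 dx^2 with rho = sqrt (det g).

- Since div u = 0, d^* u^b = 0, hence the momentum equation lowered by g reads
  D_t u^b + (nabla_u u)^b + nu d^*d u^b = - dp  on U  (momentum_flat).
- Applying d and then * gives D_t omega + * d (nabla_u u)^b + nu * d (d^* a) = 0
  (viscous_vorticity), where *d(D_t u^b) = D_t omega because the time derivative
  commutes with the partial derivatives (dt_star2_d1_flat).  By definition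
  d^* a = * d * a = * d omega, so * d (d^* a) = d^* d omega; and
  d^* omega = - * d a = 0, so the viscous term is nu box omega.
- (nabla_u u)^b = i_u a + d (|u|^2 / 2) (advection_flat), so
  d (nabla_u u)^b = d i_u a = L_u (i_xi vol) = i_[u, xi] vol since da = 0 and
  div u = 0; that is, * d (nabla_u u)^b = (nabla_u xi - nabla_xi u)^b
  (star2_d1_advection, vorticity_transport).
- Hence D_t omega + nabla_u omega + nu box omega = (nabla_xi u)^b.  This is
  omega o nabla^s u, because the antisymmetric part of nabla u contributes
  a(xi, .) / 2 = vol(xi, xi, .) / 2 = 0 (vortex_stretching).

Two facts of calculus are needed besides: the symmetry of second partial
derivatives (partialC) and its analogue for one time and one space derivative
(dt_partialC), where the time may be an end point of J.  Both come from the mean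
value theorem on rectangles and the continuity of the mixed derivatives. *)

Set Implicit Arguments.
Unset Strict Implicit.
Unset Printing Implicit Defensive.

(** * Derivatives along a direction *)

Section DirectionalDerivatives.
Variables (R : realType) (V : normedModType R).
Implicit Types (f g : V -> R) (x v : V).

(** Derivatives along v are derivatives of functions of one real variable. *)
Lemma is_derive_line f v y (s df : R) :
  is_derive (s *: v + y) v f df ->
  is_derive s 1 (fun r : R => f (r *: v + y)) df.
Proof.
have quotE : (fun h : R => h^-1 *: (((fun r : R => f (r *: v + y)) \o shift s)
      (h *: 1) - f (s *: v + y))) =
    (fun h : R => h^-1 *: ((f \o shift (s *: v + y)) (h *: v) - f (s *: v + y))).
  by apply/funext => h /=; rewrite [h *: 1]mulr1 scalerDl addrA.
by case=> fd fE; split; [rewrite /derivable quotE|rewrite /derive quotE].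
Qed.

Lemma is_derive_sqrt f x v (df : R) : 0 < f x -> is_derive x v f df ->
  is_derive x v (fun y => Num.sqrt (f y)) ((2 * Num.sqrt (f x))^-1 * df).
Proof.
move=> fx0 fd.
have xE : x = (0 : R) *: v + x by rewrite scale0r add0r.
have fl : is_derive (0 : R) 1 (fun r : R => f (r *: v + x)) df.
  by apply: is_derive_line; rewrite -xE.
have : is_derive (0 : R) 1 (Num.sqrt \o (fun r : R => f (r *: v + x)))
    ((2 * Num.sqrt (f x))^-1 * df).
  by apply: is_derive1_comp; rewrite -xE; exact: is_derive1_sqrt.
have quotE : (fun h : R => h^-1 *: ((
      (Num.sqrt \o (fun r : R => f (r *: v + x))) \o shift 0) (h *: 1) -
      (Num.sqrt \o (fun r : R => f (r *: v + x))) 0)) =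
    (fun h : R => h^-1 *: (((fun y => Num.sqrt (f y)) \o shift x) (h *: v) -
      Num.sqrt (f x))).
  by apply/funext => h /=; rewrite addr0 [h *: 1]mulr1 -xE.
by case=> sd sE; split; [move: sd; rewrite /derivable quotE|
  rewrite -sE /derive quotE].
Qed.

End DirectionalDerivatives.

(** * Mixed derivatives *)

Section Mixed.
Variable R : realType.

(** The second difference of G over a rectangle is the product of its sides by
a value of each of the two mixed derivatives, taken at points of the rectangle;
hence these two values are equal. *)
Lemma mixed_MVT (G Gs Gr Gsr Grs : R -> R -> R) (s1 s2 r1 r2 : R) :
  s1 < s2 -> r1 < r2 ->
  (forall s r, s \in `[s1, s2] -> r \in `[r1, r2] ->
    [/\ is_derive s 1 (G^~ r) (Gs s r), is_derive r 1 (G s) (Gr s r),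
        is_derive r 1 (Gs s) (Gsr s r) & is_derive s 1 (Gr^~ r) (Grs s r)]) ->
  exists s r s' r', [/\ s \in `[s1, s2], r \in `[r1, r2],
    s' \in `[s1, s2], r' \in `[r1, r2] & Gsr s r = Grs s' r'].
Proof.
move=> s12 r12 GD.
have mem1 (a b : R) : a < b -> a \in `[a, b].
  by move=> ab; rewrite in_itv/= lexx ltW.
have mem2 (a b : R) : a < b -> b \in `[a, b].
  by move=> ab; rewrite in_itv/= lexx ltW.
have oc (a b c : R) : c \in `]a, b[ -> c \in `[a, b].
  by rewrite !in_itv/= => /andP[/ltW -> /ltW ->].
have mvt (f df : R -> R) (a b : R) : a < b ->
    (forall c, c \in `[a, b] -> is_derive c 1 f (df c)) ->
    exists2 c, c \in `[a, b] & f b - f a = df c * (b - a).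
  move=> ab fd.
  have fo c : c \in `]a, b[ -> is_derive c 1 f (df c) by move=> /oc; exact: fd.
  have fc : {within `[a, b], continuous f}.
    by apply: derivable_within_continuous => c /fd [].
  have [c /oc cab E] := MVT ab fo fc.
  by exists c.
have [s sI Es] : exists2 s, s \in `[s1, s2] &
    (G s2 r2 - G s2 r1) - (G s1 r2 - G s1 r1) =
    (Gs s r2 - Gs s r1) * (s2 - s1).
  apply: (mvt (fun s => G s r2 - G s r1)) => // s sI.
  have [d2 _ _ _] := GD s r2 sI (mem2 _ _ r12).
  have [d1 _ _ _] := GD s r1 sI (mem1 _ _ r12).
  exact: is_deriveB.
have [r rI Er] : exists2 r, r \in `[r1, r2] &
    Gs s r2 - Gs s r1 = Gsr s r * (r2 - r1).
  by apply: mvt => // r rI; have [] := GD s r sI rI.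
have [r' r'I Er'] : exists2 r, r \in `[r1, r2] &
    (G s2 r2 - G s1 r2) - (G s2 r1 - G s1 r1) =
    (Gr s2 r - Gr s1 r) * (r2 - r1).
  apply: (mvt (fun r => G s2 r - G s1 r)) => // r'' rI'.
  have [_ d2 _ _] := GD s2 r'' (mem2 _ _ s12) rI'.
  have [_ d1 _ _] := GD s1 r'' (mem1 _ _ s12) rI'.
  exact: is_deriveB.
have [s' s'I Es'] : exists2 s', s' \in `[s1, s2] &
    Gr s2 r' - Gr s1 r' = Grs s' r' * (s2 - s1).
  by apply: (mvt (Gr^~ r') (Grs^~ r')) => // s'' sI'; have [] := GD s'' r' sI' r'I.
exists s, r, s', r'; split=> //.
have nz : (s2 - s1) * (r2 - r1) != 0 by rewrite mulf_neq0 ?subr_eq0 ?gt_eqF.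
apply: (mulIf nz); transitivity ((G s2 r2 - G s2 r1) - (G s1 r2 - G s1 r1)).
  by rewrite Es Er; ring.
transitivity ((G s2 r2 - G s1 r2) - (G s2 r1 - G s1 r1)); first by ring.
by rewrite Er' Es'; ring.
Qed.

(** Two functions that have limits at z within A and share values taken at points
of A arbitrarily near z agree at z.  The points y and y' need not be equal, which
fits the conclusion of mixed_MVT. *)
Lemma within_cvg_eq (T : topologicalType) (A : set T) (z : T) (k1 k2 : T -> R) :
  k1 @ within A (nbhs z) --> k1 z -> k2 @ within A (nbhs z) --> k2 z ->
  (forall B, nbhs z B -> exists y y', [/\ A y, B y, A y', B y' & k1 y = k2 y']) ->
  k1 z = k2 z.
Proof.
move=> c1 c2 H; apply/eqP; rewrite -subr_eq0 -normr_le0; apply/ler_addgt0Pr => e e0.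
rewrite add0r.
have e2 : 0 < e / 2 by rewrite divr_gt0.
move/cvgrPdist_le : c1 => /(_ _ e2) c1; move/cvgrPdist_le : c2 => /(_ _ e2) c2.
have [y [y' [Ay [By1 _] Ay' [_ By2] E]]] := H _ (@filterI _ (nbhs z) _ _ _ c1 c2).
have := By1 Ay; have := By2 Ay'; rewrite -E => h2 h1.
have -> : k1 z - k2 z = (k1 z - k1 y) - (k2 z - k1 y) by ring.
by rewrite (le_trans (ler_normB _ _))// (splitr e) lerD.
Qed.

End Mixed.

(** * Partial derivatives and smooth functions *)

Section PartialDerivatives.
Variables (R : realType) (n : nat).
Implicit Types (U : set 'rV[R]_n) (f g : 'rV[R]_n -> R) (i j : 'I_n).

Lemma partial_ext U f g i x : open U -> U x -> {in U, f =1 g} ->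
  partial i f x = partial i g x.
Proof.
move=> Uo Ux fg; apply: near_eq_derive.
near=> y; apply: fg; rewrite inE; near: y; exact: open_nbhs_nbhs.
Unshelve. all: by end_near.
Qed.

Lemma derivable_ext U f g i x : open U -> U x -> {in U, f =1 g} ->
  derivable f x (basis_vec R i) -> derivable g x (basis_vec R i).
Proof.
move=> Uo Ux fg; apply: near_eq_derivable.
near=> y; apply: fg; rewrite inE; near: y; exact: open_nbhs_nbhs.
Unshelve. all: by end_near.
Qed.

Lemma derivable_sumf (m : nat) (F : 'I_m -> 'rV[R]_n -> R) x v :
  (forall k, derivable (F k) x v) ->
  derivable (fun y => \sum_(k < m) F k y) x v.
Proof. by move=> Fd; rewrite -fct_sumE; exact: derivable_sum. Qed.

Lemma partial_sum (m : nat) (F : 'I_m -> 'rV[R]_n -> R) i x :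
  (forall k, derivable (F k) x (basis_vec R i)) ->
  partial i (fun y => \sum_(k < m) F k y) x = \sum_(k < m) partial i (F k) x.
Proof. by move=> Fd; rewrite /partial -fct_sumE derive_sum. Qed.

Lemma partialM f g i x :
  derivable f x (basis_vec R i) -> derivable g x (basis_vec R i) ->
  partial i (fun y => f y * g y) x = f x * partial i g x + g x * partial i f x.
Proof. exact: deriveM. Qed.

Lemma partialD f g i x :
  derivable f x (basis_vec R i) -> derivable g x (basis_vec R i) ->
  partial i (fun y => f y + g y) x = partial i f x + partial i g x.
Proof. exact: deriveD. Qed.

Lemma partialB f g i x :
  derivable f x (basis_vec R i) -> derivable g x (basis_vec R i) ->
  partial i (fun y => f y - g y) x = partial i f x - partial i g x.
Proof. exact: deriveB. Qed.

Lemma partialZ (a : R) f i x : derivable f x (basis_vec R i) ->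
  partial i (fun y => a * f y) x = a * partial i f x.
Proof. by move=> fd; rewrite /partial -deriveMl. Qed.

Lemma partial_cst (a : R) i x : partial i (fun=> a) x = 0.
Proof. exact: derive_cst. Qed.

Lemma class_C_ext k U f g : open U -> {in U, f =1 g} ->
  class_C k U f -> class_C k U g.
Proof.
move=> Uo; elim: k f g => [|k IH] f g fg /=.
  by case=> fc _; split => //; exact: subspace_eq_continuous fg fc.
case=> fc fD; split; first exact: subspace_eq_continuous fg fc.
move=> i; have [fd fC] := fD i; split.
  by move=> x Ux; apply: (derivable_ext Uo Ux fg); exact: fd.
apply: IH fC => x; rewrite inE => Ux; exact: partial_ext Ux fg.
Qed.

Lemma class_CD k U f g : open U ->
  class_C k U f -> class_C k U g -> class_C k U (fun y => f y + g y).
Proof.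
move=> Uo; elim: k f g => [|k IH] f g /= [fc fD] [gc gD].
  by split=> // x; apply: cvgD; [exact: fc|exact: gc].
split=> [x|i]; first by apply: cvgD; [exact: fc|exact: gc].
have [fd fC] := fD i; have [gd gC] := gD i; split.
  by move=> x Ux; apply: derivableD; [exact: fd|exact: gd].
apply: class_C_ext (IH _ _ fC gC) => // x; rewrite inE => Ux.
by rewrite partialD//; [exact: fd|exact: gd].
Qed.

Lemma class_C_pred k U f : class_C k.+1 U f -> class_C k U f.
Proof.
elim: k f => [f []//|k IH] f [fc fD]; split=> // i.
by have [fd fC] := fD i; split=> //; exact: IH.
Qed.

Lemma class_CM k U f g : open U ->
  class_C k U f -> class_C k U g -> class_C k U (fun y => f y * g y).
Proof.
move=> Uo; elim: k f g => [|k IH] f g fC' gC'.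
  case: fC' gC' => fc _ [gc _].
  by split=> // x; apply: cvgM; [exact: fc|exact: gc].
have := class_C_pred fC'; have := class_C_pred gC'.
case: fC' gC' => fc fD [gc gD] gCk fCk.
split=> [x|i]; first by apply: cvgM; [exact: fc|exact: gc].
have [fd fC] := fD i; have [gd gC] := gD i; split.
  by move=> x Ux; apply: derivableM; [exact: fd|exact: gd].
apply: class_C_ext (class_CD Uo (IH _ _ fCk gC) (IH _ _ gCk fC)) => // x.
by rewrite inE => Ux; rewrite partialM//; [exact: fd|exact: gd].
Qed.

Lemma class_C_cst k U (a : R) : class_C k U (fun=> a).
Proof.
have ccst (b : R) : {within U, continuous (fun _ : 'rV[R]_n => b)}.
  by move=> x; exact: cvg_cst.
elim: k a => [|k IH] a; split=> // i; split=> [x _|]; first exact: derivable_cst.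
by rewrite (_ : partial i _ = fun=> 0)//; apply/funext => x; exact: partial_cst.
Qed.

Lemma smooth_onM U f g : open U ->
  smooth_on U f -> smooth_on U g -> smooth_on U (fun y => f y * g y).
Proof. by move=> Uo fs gs k; apply: class_CM. Qed.

Lemma smooth_onZ U (a : R) f : open U ->
  smooth_on U f -> smooth_on U (fun y => a * f y).
Proof. by move=> Uo fs k; apply: class_CM => //; exact: class_C_cst. Qed.

Lemma smooth_on_sum U (m : nat) (F : 'I_m -> 'rV[R]_n -> R) : open U ->
  (forall k, smooth_on U (F k)) -> smooth_on U (fun y => \sum_(k < m) F k y).
Proof.
move=> Uo; elim: m F => [|m IH] F Fs k.
  rewrite (_ : (fun _ => _) = fun=> 0); first exact: class_C_cst.
  by apply/funext => y; rewrite big_ord0.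
rewrite (_ : (fun _ => _) = fun y =>
  F ord0 y + \sum_(k0 < m) F (lift ord0 k0) y); last first.
  by apply/funext => y; rewrite big_ord_recl.
by apply: class_CD => //; [exact: Fs|exact: IH].
Qed.

Lemma smooth_on_derivable U f i x : smooth_on U f -> U x ->
  derivable f x (basis_vec R i).
Proof. by move=> /(_ 1%N) [_ /(_ i) [fd _]]; exact: fd. Qed.

Lemma smooth_on_partial U f i : smooth_on U f -> smooth_on U (partial i f).
Proof. by move=> fs k; have [_ /(_ i) []] := fs k.+1. Qed.

(** Schwarz's theorem. *)
Lemma partialC U f i j x : open U -> smooth_on U f -> U x ->
  partial i (partial j f) x = partial j (partial i f) x.
Proof.
move=> Uo fs Ux.
have contp h : smooth_on U h -> h @ within U (nbhs x) --> h x.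
  by move=> /(_ 0%N) [] /subspace_continuousP/(_ x Ux).
apply: (@within_cvg_eq _ _ U).
- by apply: contp; do 2 apply: smooth_on_partial.
- by apply: contp; do 2 apply: smooth_on_partial.
move=> B xB.
(* Near x, the plane through x spanned by the two basis vectors contains small
   rectangles [0, e / 2] x [0, e / 2] on which the mean value theorem applies. *)
pose pt (s r : R) := s *: basis_vec R i + (r *: basis_vec R j + x).
have : nbhs x (U `&` B) by apply: filterI => //; exact: open_nbhs_nbhs.
have ptc : (fun z : R * R => pt z.1 z.2) @ (nbhs (0 : R, 0 : R)) --> x.
  rewrite [X in _ --> X](_ : x =
      (0 : R) *: basis_vec R i + ((0 : R) *: basis_vec R j + x)).
    apply: cvgD; first by apply: cvgZr_tmp; exact: cvg_fst.
    apply: cvgD; last exact: cvg_cst.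
    by apply: cvgZr_tmp; exact: cvg_snd.
  by rewrite !scale0r !add0r.
move=> /ptc; rewrite /nbhs/= => -[[A A'] [/= A0 A'0] AA'].
have : nbhs (0 : R) (A `&` A') by exact: filterI.
move=> /nbhs_ballP[e /= e0 eA].
have inU s r : s \in `[0, e / 2] -> r \in `[0, e / 2] -> (U `&` B) (pt s r).
  rewrite !in_itv/= => /andP[s0 se] /andP[r0 re]; apply: (AA' (s, r)).
  have he : e / 2 < e by rewrite ltr_pdivrMr// ltr_pMr// ltr1n.
  split=> /=.
    by have [] := eA s; rewrite // /ball/= sub0r normrN ger0_norm// (le_lt_trans se).
  by have [] := eA r; rewrite // /ball/= sub0r normrN ger0_norm// (le_lt_trans re).
have e2 : 0 < e / 2 by rewrite divr_gt0.
have dl h k y s : smooth_on U h -> U (s *: basis_vec R k + y) ->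
    is_derive s 1 (fun r : R => h (r *: basis_vec R k + y))
      (partial k h (s *: basis_vec R k + y)).
  move=> hs hU; apply: is_derive_line; apply: DeriveDef => //.
  exact: smooth_on_derivable hU.
have ptE s r : pt s r = r *: basis_vec R j + (s *: basis_vec R i + x).
  by rewrite /pt addrCA.
have [|s [r [s' [r' [sI rI s'I r'I E]]]]] := @mixed_MVT R (fun s r => f (pt s r))
   (fun s r => partial i f (pt s r)) (fun s r => partial j f (pt s r))
   (fun s r => partial j (partial i f) (pt s r))
   (fun s r => partial i (partial j f) (pt s r)) 0 (e / 2) 0 (e / 2) e2 e2.
  move=> s r sI rI; have [Usr _] := inU s r sI rI; split.
  - exact: dl.
  - rewrite (_ : (fun r : R => f (pt s r)) = fun r =>
      f (r *: basis_vec R j + (s *: basis_vec R i + x))); last first.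
      by apply/funext => r''; rewrite ptE.
    by rewrite ptE; apply: dl => //; rewrite -ptE.
  - rewrite (_ : (fun r : R => partial i f (pt s r)) = fun r =>
      partial i f (r *: basis_vec R j + (s *: basis_vec R i + x))); last first.
      by apply/funext => r''; rewrite ptE.
    by rewrite ptE; apply: dl => //; [exact: smooth_on_partial|rewrite -ptE].
  - by apply: dl => //; exact: smooth_on_partial.
have [Usr Bsr] := inU s r sI rI; have [Usr' Bsr'] := inU s' r' s'I r'I.
by exists (pt s' r'), (pt s r); split; [exact: Usr'|exact: Bsr'|exact: Usr|
  exact: Bsr|exact: esym E].
Qed.

End PartialDerivatives.

(** * Time derivatives *)

Section TimeDerivative.
Variables (R : realType) (J : set R).
Hypotheses (Ji : is_interval J) (Jn : exists a b, [/\ J a, J b & a < b]).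
Implicit Types (f : R -> R) (t : R).

(** Near any point t of J, even an end point, lies a nondegenerate segment in the
interior of J; it can be chosen with left end point distinct from t. *)
Lemma interval_subsegment t (e : R) : J t -> 0 < e ->
  exists a b, [/\ a < b, a != t, forall s, s \in `[a, b] -> nbhs s J &
    forall s, s \in `[a, b] -> `|t - s| < e].
Proof.
move=> Jt e0.
(* It suffices to have end points a and b in J, with t in [a, b] and b - a < e. *)
suff H (a b : R) : J a -> J b -> a < b -> t \in `[a, b] -> b - a < e ->
    exists a b, [/\ a < b, a != t, forall s, s \in `[a, b] -> nbhs s J &
      forall s, s \in `[a, b] -> `|t - s| < e].
  have [s Js st] : exists2 s, J s & s != t.
    have [a [b [Ja Jb ab]]] := Jn.
    have [E|ne] := eqVneq a t; last by exists a.
    by exists b => //; rewrite -E gt_eqF.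
  have e2 : 0 < e / 2 by rewrite divr_gt0.
  have [lt|lt|E] := ltgtP s t; last by rewrite E eqxx in st.
  - pose a := Num.max s (t - e / 2).
    have at_ : a < t by rewrite gt_max lt/=; lra.
    have as_ : s <= a by rewrite le_max lexx.
    have ae : t - e / 2 <= a by rewrite le_max lexx orbT.
    apply: (H a t) => //; first by apply: (Ji Js Jt); rewrite as_ ltW.
      by rewrite in_itv/= lexx ltW.
    by lra.
  - pose b := Num.min s (t + e / 2).
    have tb : t < b by rewrite lt_min lt/=; lra.
    have bs : b <= s by rewrite ge_min lexx.
    have be : b <= t + e / 2 by rewrite ge_min lexx orbT.
    apply: (H t b) => //; first by apply: (Ji Jt Js); rewrite bs ltW.
      by rewrite in_itv/= lexx ltW.
    by lra.
move=> Ja Jb ab; rewrite in_itv/= => /andP[a_t t_b] abe.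
have open_sub (s : R) : a < s < b -> nbhs s J.
  move=> sI; apply: (@filterS _ (nbhs s) _ `]a, b[%classic).
    by move=> z; rewrite /= in_itv/= => /andP[az zb]; apply: (Ji Ja Jb); rewrite !ltW.
  by apply: open_nbhs_nbhs; split; [exact: interval_open|rewrite /= in_itv].
(* The segment is the middle third of [a, b], or the right half of that third
   if the third starts at t. *)
suff Hd (c d : R) : c < d -> c != t -> a < c -> d < b ->
    exists a b, [/\ a < b, a != t, forall s, s \in `[a, b] -> nbhs s J &
      forall s, s \in `[a, b] -> `|t - s| < e].
  have [E|ne] := eqVneq (a + (b - a) / 3) t.
    by apply: (Hd (a + (b - a) / 2) (a + 2 * (b - a) / 3)); lra.
  by apply: (Hd (a + (b - a) / 3) (a + 2 * (b - a) / 3)); lra.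
move=> cd ct ac db; exists c, d; split => // s; rewrite in_itv/= => /andP[cs sd].
  by apply: open_sub; lra.
by rewrite ltr_norml; lra.
Qed.

(** The limit defining dt is taken along a proper filter, so it is unique. *)
Lemma dt_proper t : J t -> ProperFilter (within [set h | J (h + t)] (0 : R)^').
Proof.
move=> Jt; apply: Build_ProperFilter_ex => B /= B0.
have [e /= e0 eB] := B0.
have [a [b [ab at_ aJ ae]]] := interval_subsegment Jt e0.
have aI : a \in `[a, b] by rewrite in_itv/= lexx ltW.
exists (a - t); apply: eB => /=.
- by rewrite sub0r opprB; exact: ae.
- by rewrite subr_eq0.
- by rewrite subrK; exact: nbhs_singleton (aJ _ aI).
Qed.

(** l is the derivative of f at t within J; the relational form of dt. *)
Definition has_dt f t (l : R) : Prop :=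
  dt_quotient J f t @ within [set h | J (h + t)] 0^' --> l.

Lemma has_dtE f t (l : R) : J t -> has_dt f t l -> dt J f t = l.
Proof.
by move=> Jt ftl; have P := dt_proper Jt; apply: cvg_lim => //; exact: Rhausdorff.
Qed.

Lemma dt_derivableP f t : dt_derivable J f t -> has_dt f t (dt J f t).
Proof. by []. Qed.

Lemma has_dtM f t (c l : R) : has_dt f t l -> has_dt (fun s => c * f s) t (c * l).
Proof.
move=> fl; rewrite /has_dt (_ : dt_quotient _ _ _ =
  fun h => c * dt_quotient J f t h); first by apply: cvgM; [exact: cvg_cst|exact: fl].
by apply/funext => h; rewrite /dt_quotient; ring.
Qed.

Lemma has_dtD f1 f2 t (l1 l2 : R) : has_dt f1 t l1 -> has_dt f2 t l2 ->
  has_dt (fun s => f1 s + f2 s) t (l1 + l2).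
Proof.
move=> fl1 fl2; rewrite /has_dt (_ : dt_quotient _ _ _ =
  fun h => dt_quotient J f1 t h + dt_quotient J f2 t h); first exact: cvgD.
by apply/funext => h; rewrite /dt_quotient; ring.
Qed.

Lemma has_dt_sum (m : nat) (F : 'I_m -> R -> R) t (l : 'I_m -> R) :
  (forall k, has_dt (F k) t (l k)) ->
  has_dt (fun s => \sum_(k < m) F k s) t (\sum_(k < m) l k).
Proof.
elim: m F l => [|m IH] F l Fl.
  rewrite (_ : (fun _ => _) = fun=> 0); last first.
    by apply/funext => s; rewrite big_ord0.
  rewrite big_ord0 /has_dt (_ : dt_quotient _ _ _ = fun=> 0); first exact: cvg_cst.
  by apply/funext => h; rewrite /dt_quotient subrr mulr0.
rewrite (_ : (fun _ => _) = fun s =>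
  F ord0 s + \sum_(k < m) F (lift ord0 k) s); last first.
  by apply/funext => s; rewrite big_ord_recl.
rewrite big_ord_recl; apply: has_dtD; first exact: Fl.
by apply: IH => k; exact: Fl.
Qed.

Lemma has_dt_ext f1 f2 t (l : R) : J t -> {in J, f1 =1 f2} ->
  has_dt f2 t l -> has_dt f1 t l.
Proof.
move=> Jt f12; apply: cvg_trans; apply: near_eq_cvg.
near=> h; rewrite /dt_quotient !f12 ?inE//; near: h.
exact: withinT.
Unshelve. all: by end_near.
Qed.

Lemma dt_derivable_interior f t : nbhs t J -> dt_derivable J f t ->
  is_derive t 1 f (dt J f t).
Proof.
move=> Jt fd.
have Jh : \forall h \near (0 : R)^', J (h + t).
  apply: nbhs_dnbhs.
  have hc : (fun h : R => h + t) @ nbhs 0 --> t.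
    by rewrite -[X in _ --> X](add0r t); apply: cvgD; [exact: cvg_id|exact: cvg_cst].
  exact: hc Jt.
have cv : (fun h : R => h^-1 *: ((f \o shift t) (h *: 1) - f t)) @ 0^' --> dt J f t.
  rewrite (_ : (fun h : R => _) = dt_quotient J f t); last first.
    by apply/funext => h /=; rewrite [h *: 1]mulr1.
  apply: cvg_trans (dt_derivableP fd); apply: cvg_app => A.
  by move=> AJ; apply: (@filterS2 _ ((0 : R)^') _ _ _ A _ AJ Jh) => h; exact.
split; first by apply/cvg_ex; exists (dt J f t).
exact: cvg_lim cv.
Qed.

Variable n : nat.
Implicit Types (U : set 'rV[R]_n) (F : R -> 'rV[R]_n -> R).

Lemma time_smooth_dt_derivable U F t x : time_smooth_on J U F -> J t -> U x ->
  dt_derivable J (F ^~ x) t.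
Proof. by move=> /(_ 1%N) [_ [Fd _ _]]; exact: Fd. Qed.

Lemma time_smooth_dt U F : time_smooth_on J U F ->
  time_smooth_on J U (fun t x => dt J (F ^~ x) t).
Proof. by move=> Fs k; have [_ []] := Fs k.+1. Qed.

Lemma time_smooth_partial U F i : time_smooth_on J U F ->
  time_smooth_on J U (fun t => partial i (F t)).
Proof. by move=> Fs k; have [_ [_ _ /(_ i) []]] := Fs k.+1. Qed.

Lemma time_smooth_cvg U F t x : time_smooth_on J U F -> J t -> U x ->
  (fun z : R * 'rV[R]_n => F z.1 z.2) @ within (J `*` U) (nbhs (t, x)) --> F t x.
Proof.
move=> /(_ 0%N) [] /subspace_continuousP/(_ (t, x)) Fc _ Jt Ux.
by apply: Fc; split.
Qed.

Lemma time_smooth_smooth U F t : time_smooth_on J U F -> J t -> smooth_on U (F t).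
Proof.
move=> Fs Jt k; elim: k F Fs => [|k IH] F Fs.
  split=> //; apply/subspace_continuousP => x Ux.
  have Fc := time_smooth_cvg Fs Jt Ux.
  have ptc : (fun y => (t, y)) @ within U (nbhs x) -->
      within (J `*` U) (nbhs (t, x)).
    move=> A [[B C] [/= tB xC] BCA].
    apply: (@filterS _ (nbhs x) _ C _ _ xC) => y Cy Uy; apply: (BCA (t, y)) => //.
    by split=> //=; exact: nbhs_singleton tB.
  exact: (cvg_comp _ _ ptc Fc).
split; first by case: (k) (IH F Fs) => [|k'] [].
move=> i; split; last exact: (IH _ (time_smooth_partial i Fs)).
by have [_ [_ _ /(_ i) [Fd _]]] := Fs 1%N => x; exact: Fd.
Qed.

(** Time and space derivatives commute.  The mean value theorem is applied in the
interior of J, where dt is an ordinary derivative; joint continuity on J x U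
reaches the end points. *)
Lemma dt_partialC U F i t x : open U -> time_smooth_on J U F -> J t -> U x ->
  dt J (fun s => partial i (F s) x) t = partial i (fun y => dt J (F ^~ y) t) x.
Proof.
move=> Uo Fs Jt Ux.
pose k1 (z : R * 'rV[R]_n) := dt J (fun s => partial i (F s) z.2) z.1.
pose k2 (z : R * 'rV[R]_n) := partial i (fun y => dt J (F ^~ y) z.1) z.2.
apply: (@within_cvg_eq _ _ (J `*` U) (t, x) k1 k2).
- exact: (time_smooth_cvg (time_smooth_dt (time_smooth_partial i Fs)) Jt Ux).
- exact: (time_smooth_cvg (time_smooth_partial i (time_smooth_dt Fs)) Jt Ux).
move=> B [[C D] [/= tC xD] CDB].
have [e /= e0 eC] := tC.
have [a [b [ab _ abJ abe]]] := interval_subsegment Jt e0.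
pose pt (r : R) := r *: basis_vec R i + x.
have [d d0 dUD] : exists2 d, 0 < d & forall r, r \in `[0, d] -> (U `&` D) (pt r).
  have UD : nbhs x (U `&` D) by apply: filterI => //; exact: open_nbhs_nbhs.
  have ptc : pt @ nbhs (0 : R) --> x.
    rewrite -[X in _ --> X](_ : (0 : R) *: basis_vec R i + x = x).
      apply: cvgD; last exact: cvg_cst.
      by apply: cvgZr_tmp; exact: cvg_id.
    by rewrite scale0r add0r.
  have [d /= d0 dUD] := ptc _ UD.
  exists (d / 2); first by rewrite divr_gt0.
  move=> r; rewrite in_itv/= => /andP[r0 rd]; apply: dUD => /=.
  by rewrite sub0r normrN ger0_norm//; lra.
have dl h r : smooth_on U h -> U (pt r) ->
    is_derive r 1 (fun r : R => h (pt r)) (partial i h (pt r)).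
  move=> hs hU; apply: is_derive_line; apply: DeriveDef => //.
  exact: smooth_on_derivable hU.
have dtl H s r : time_smooth_on J U H -> nbhs s J -> U (pt r) ->
    is_derive s 1 (fun s => H s (pt r)) (dt J (H ^~ (pt r)) s).
  move=> Hs sJ hU; apply: dt_derivable_interior => //.
  by apply: time_smooth_dt_derivable Hs _ hU; exact: nbhs_singleton sJ.
have [|s [r [s' [r' [sI rI s'I r'I E]]]]] := @mixed_MVT R (fun s r => F s (pt r))
   (fun s r => dt J (F ^~ (pt r)) s) (fun s r => partial i (F s) (pt r))
   (fun s r => k2 (s, pt r)) (fun s r => k1 (s, pt r)) a b 0 d ab d0.
  move=> s r sI rI; have [Ur _] := dUD r rI; have sJ := abJ s sI.
  have Js := nbhs_singleton sJ; split.
  - exact: dtl.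
  - by apply: dl => //; exact: time_smooth_smooth.
  - apply: (dl (fun y => dt J (F ^~ y) s)) => //.
    exact: (time_smooth_smooth (time_smooth_dt Fs) Js).
  - apply: (dtl (fun t => partial i (F t))) => //.
    exact: time_smooth_partial.
have inJUB s0 r0 : s0 \in `[a, b] -> r0 \in `[0, d] ->
    (J `*` U) (s0, pt r0) /\ B (s0, pt r0).
  move=> sI0 rI0; have [Ur Dr] := dUD r0 rI0; split.
    by split; [exact: nbhs_singleton (abJ _ sI0)|exact: Ur].
  by apply: CDB; split; [apply: eC; exact: abe|exact: Dr].
have [Hs Bs] := inJUB s r sI rI; have [Hs' Bs'] := inJUB s' r' s'I r'I.
by exists (s', pt r'), (s, pt r); split; [exact: Hs'|exact: Bs'|exact: Hs|
  exact: Bs|exact: esym E].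
Qed.

End TimeDerivative.

(** * Algebra of the Levi-Civita symbol *)

Section Algebra3.
Variable R : realType.
Local Notation o0 := (@Ordinal 3 0 isT).
Local Notation o1 := (@Ordinal 3 1 isT).
Local Notation o2 := (@Ordinal 3 2 isT).

Lemma sum3E (F : 'I_3 -> R) : \sum_(i < 3) F i = F o0 + F o1 + F o2.
Proof.
rewrite !big_ord_recl big_ord0 addr0 addrA.
by congr (F _ + F _ + F _); exact: val_inj.
Qed.

Lemma ord3_ind (P : 'I_3 -> Prop) : P o0 -> P o1 -> P o2 -> forall i, P i.
Proof.
move=> P0 P1 P2 [[|[|[|//]]] h].
- by rewrite (_ : Ordinal h = o0)//; exact: val_inj.
- by rewrite (_ : Ordinal h = o1)//; exact: val_inj.
- by rewrite (_ : Ordinal h = o2)//; exact: val_inj.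
Qed.

(** Expansion of a determinant of size 3. *)
Lemma det_mx3 (A : 'M[R]_3) : \det A =
  A o0 o0 * (A o1 o1 * A o2 o2 - A o1 o2 * A o2 o1)
  - A o0 o1 * (A o1 o0 * A o2 o2 - A o1 o2 * A o2 o0)
  + A o0 o2 * (A o1 o0 * A o2 o1 - A o1 o1 * A o2 o0).
Proof.
(* Indexing the entries by natural numbers lets the indices of minors compute. *)
pose a (i j : nat) := A (inord i) (inord j).
have aE i j : A i j = a i j by rewrite /a !inord_val.
have -> : A = \matrix_(i, j) a i j by apply/matrixP => i j; rewrite mxE aE.
rewrite (expand_det_row _ ord0) !big_ord_recl big_ord0 /cofactor.
rewrite !(expand_det_row _ ord0) !big_ord_recl !big_ord0 /cofactor.
by rewrite !det_mx11 !mxE /= /bump /=; ring.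
Qed.

Lemma epsilon_det (A : 'M[R]_3) m n p :
  \sum_(i < 3) \sum_(j < 3) \sum_(k < 3)
    epsilon R i j k * A i m * A j n * A k p = \det A * epsilon R m n p.
Proof.
rewrite det_mx3 /epsilon !sum3E.
by move: m n p; do 3 (apply: ord3_ind); rewrite /=; field.
Qed.

(** The cofactor formula: for distinct m and n, the cross product of columns m and n
of A is, up to sign, det A times the row of the inverse matrix B with the
remaining index. *)
Lemma epsilon_mul_inv (A B : 'M[R]_3) m n k : A *m B = 1%:M ->
  \sum_(i < 3) \sum_(j < 3) epsilon R i j k * A i m * A j n =
  \det A * \sum_(p < 3) epsilon R m n p * B p k.
Proof.
move=> /matrixP AB.
transitivity (\sum_(p < 3) (\sum_(i < 3) \sum_(j < 3) \sum_(k < 3)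
    epsilon R i j k * A i m * A j n * A k p) * B p k); last first.
  rewrite mulr_sumr; apply: eq_bigr => p _.
  by rewrite epsilon_det; ring.
transitivity (\sum_(l < 3) (\sum_(p < 3) A l p * B p k) *
    \sum_(i < 3) \sum_(j < 3) epsilon R i j l * A i m * A j n); last first.
  by rewrite !sum3E; ring.
rewrite [RHS](bigD1 k)//= [X in _ + X]big1 ?addr0.
  by have := AB k k; rewrite !mxE eqxx => ->; rewrite mul1r.
move=> l /negPf lk; have := AB l k; rewrite !mxE lk => ->; exact: mul0r.
Qed.

Lemma det3_gt0 (A : 'M[R]_3) : A^T = A ->
  (forall v : 'rV[R]_3, v != 0 -> 0 < (v *m A *m v^T) 0 0) -> 0 < \det A.
Proof.
move=> /matrixP As Apos.
have sym i j : A i j = A j i by rewrite -[LHS]As mxE.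
have quadE (v : 'rV[R]_3) : (v *m A *m v^T) 0 0 =
    \sum_(j < 3) (\sum_(i < 3) v 0 i * A i j) * v 0 j.
  by rewrite !mxE; apply: eq_bigr => j _; rewrite !mxE.
pose vec (a b c : R) : 'rV[R]_3 := \row_j [:: a; b; c]`_j.
have Q (a b c : R) : (a != 0) || (b != 0) || (c != 0) ->
    0 < \sum_(j < 3) (\sum_(i < 3) vec a b c 0 i * A i j) * vec a b c 0 j.
  move=> abc; rewrite -quadE; apply: Apos; apply: contraTN abc.
  move=> /eqP/matrixP v0; rewrite !negb_or !negbK.
  have := v0 0 o0; have := v0 0 o1; have := v0 0 o2; rewrite !mxE /= => -> -> ->.
  by rewrite eqxx.
(* Sylvester's criterion: the form is evaluated successively at (1, 0, 0), at
   (- A01, A00, 0) and at the row of cofactors of the last column, where its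
   value is the product of two consecutive leading minors. *)
have a0 : 0 < A o0 o0.
  have := Q 1 0 0; rewrite oner_neq0 => /(_ isT).
  by rewrite !sum3E !mxE /=; lra.
have m0 : 0 < A o0 o0 * A o1 o1 - A o0 o1 ^+ 2.
  have := Q (- A o0 o1) (A o0 o0) 0; rewrite (gt_eqF a0) orbT => /(_ isT).
  rewrite !sum3E !mxE /= (sym o1 o0).
  rewrite (_ : _ + _ + _ = A o0 o0 * (A o0 o0 * A o1 o1 - A o0 o1 ^+ 2));
    last by ring.
  by rewrite pmulr_rgt0.
have := Q (A o0 o1 * A o1 o2 - A o0 o2 * A o1 o1)
          (A o0 o2 * A o0 o1 - A o0 o0 * A o1 o2)
          (A o0 o0 * A o1 o1 - A o0 o1 ^+ 2).
rewrite (gt_eqF m0) orbT => /(_ isT).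
rewrite det_mx3 !sum3E !mxE /= (sym o1 o0) (sym o2 o0) (sym o2 o1).
set d := (X in _ -> _ < X).
rewrite (_ : _ + _ + _ = (A o0 o0 * A o1 o1 - A o0 o1 ^+ 2) * d); last first.
  by rewrite /d; ring.
by rewrite pmulr_rgt0.
Qed.

(** The components of a 2-form a viewed as an axial vector density:
axial a 0 = a_{1 2} and cyclically, if a is antisymmetric. *)
Definition axial (a : 'I_3 -> 'I_3 -> R) (l : 'I_3) : R :=
  2^-1 * \sum_(i < 3) \sum_(j < 3) epsilon R l i j * a i j.

Lemma axialK (a : 'I_3 -> 'I_3 -> R) i j : (forall i j, a i j = - a j i) ->
  \sum_(k < 3) axial a k * epsilon R k i j = a i j.
Proof.
move=> aN; have a0 i' : a i' i' = 0.
  by have /eqP := aN i' i'; rewrite -addr_eq0 -mulr2n mulrn_eq0 => /eqP.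
rewrite /axial /epsilon !sum3E !a0 (aN o1 o0) (aN o2 o0) (aN o2 o1).
move: i j; do 2 (apply: ord3_ind);
  rewrite ?a0 ?(aN o1 o0) ?(aN o2 o0) ?(aN o2 o1) /=; by field.
Qed.

(** The algebra behind d i_W (dx^0 dx^1 dx^2) = (sum_l d_l W^l) dx^0 dx^1 dx^2,
with p i l for d_i W^l. *)
Lemma epsilon_trace (p : 'I_3 -> 'I_3 -> R) i j k :
  \sum_(l < 3) p i l * epsilon R l j k + \sum_(l < 3) p j l * epsilon R l k i
  + \sum_(l < 3) p k l * epsilon R l i j =
  (\sum_(l < 3) p l l) * epsilon R i j k.
Proof.
rewrite /epsilon !sum3E.
by move: i j k; do 3 (apply: ord3_ind); rewrite /=; field.
Qed.

(** The algebra behind the coordinate formula for the exterior derivative of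
i_u i_w (dx^0 dx^1 dx^2), with du l i for d_l u^i and dw l i for d_l w^i. *)
Lemma axial_lie (u w : 'I_3 -> R) (du dw : 'I_3 -> 'I_3 -> R) n :
  let e l m := \sum_(i < 3) (u i * (\sum_(k < 3) dw l k * epsilon R k i m)
      + (\sum_(k < 3) w k * epsilon R k i m) * du l i) in
  axial (fun l m => e l m - e m l) n =
  w n * (\sum_(l < 3) du l l) + \sum_(l < 3) u l * dw l n
  - \sum_(l < 3) w l * du l n - u n * \sum_(l < 3) dw l l.
Proof.
rewrite /axial /epsilon !sum3E.
by move: n; apply: ord3_ind; rewrite /=; field.
Qed.

(** The algebra behind d d = 0 on 1-forms, with q i j k for d_i d_j b_k. *)
Lemma epsilon_symm (q : 'I_3 -> 'I_3 -> 'I_3 -> R) :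
  (forall i j k, q i j k = q j i k) ->
  \sum_(l < 3) (2^-1 * \sum_(i < 3) \sum_(j < 3) epsilon R l i j *
    (q l i j - q l j i)) = 0.
Proof.
move=> qC; rewrite /epsilon !sum3E.
by rewrite !(qC o1 o0) !(qC o2 o0) !(qC o2 o1) /=; field.
Qed.

(** The algebra behind (nabla_X X)^b = i_X d(X^b) + d(|X|^2 / 2) for the metric A and
a torsion-free connection G; the assumption on b, where b i j stands for the
partial derivative d_i f_j, says that lowering an index commutes with
covariant differentiation. *)
Lemma advection_algebra (A : 'I_3 -> 'I_3 -> R) (G : 'I_3 -> 'I_3 -> 'I_3 -> R)
    (X : 'I_3 -> R) (dX b : 'I_3 -> 'I_3 -> R) j :
  (forall i j, A i j = A j i) -> (forall k i j, G k i j = G k j i) ->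
  let f l := \sum_(m < 3) A l m * X m in
  let c i k := dX i k + \sum_(m < 3) G k i m * X m in
  (forall i j, b i j = \sum_(k < 3) A j k * c i k + \sum_(k < 3) G k i j * f k) ->
  \sum_(k < 3) A j k * \sum_(i < 3) X i * c i k =
  \sum_(i < 3) X i * (b i j - b j i)
    + 2^-1 * \sum_(i < 3) (X i * b j i + f i * dX j i).
Proof.
move=> As Gs f c bE; under eq_bigr do rewrite mulr_sumr.
under [X in _ = X + _]eq_bigr do rewrite !bE.
under [X in _ = _ + _ * X]eq_bigr do rewrite !bE.
rewrite /c /f !sum3E !(Gs _ o1 o0) !(Gs _ o2 o0) !(Gs _ o2 o1).
by move: j; apply: ord3_ind; rewrite ?(As o1 o0) ?(As o2 o0) ?(As o2 o1)
  ?(Gs _ o1 o0) ?(Gs _ o2 o0) ?(Gs _ o2 o1); field.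
Qed.

(** nabla_X Y - [X, Y] = nabla_Y X for a torsion-free connection G, with an index
lowered by A. *)
Lemma bracket_algebra (A : 'I_3 -> 'I_3 -> R) (G : 'I_3 -> 'I_3 -> 'I_3 -> R)
    (X Y : 'I_3 -> R) (dX dY : 'I_3 -> 'I_3 -> R) j :
  (forall k i j, G k i j = G k j i) ->
  \sum_(i < 3) X i * (\sum_(k < 3) A j k * (dY i k + \sum_(m < 3) G k i m * Y m))
  - \sum_(k < 3) A j k *
      (\sum_(l < 3) X l * dY l k - \sum_(l < 3) Y l * dX l k) =
  \sum_(k < 3) A j k *
     \sum_(l < 3) Y l * (dX l k + \sum_(m < 3) G k l m * X m).
Proof.
move=> Gs; rewrite !sum3E !(Gs _ o1 o0) !(Gs _ o2 o0) !(Gs _ o2 o1).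
by ring.
Qed.

(** The covariant derivative c of a vector field in the direction X equals its
symmetric part applied to X, if the antisymmetric part of c is proportional to
i_X vol. *)
Lemma stretching_algebra (A : 'I_3 -> 'I_3 -> R) (c : 'I_3 -> 'I_3 -> R)
    (X : 'I_3 -> R) (r : R) j :
  (forall i j, A i j = A j i) ->
  (forall i p, \sum_(l < 3) A p l * c i l - \sum_(l < 3) A i l * c p l =
     r * \sum_(k < 3) X k * epsilon R k i p) ->
  \sum_(p < 3) X p *
    (2^-1 * \sum_(l < 3) (c j l * A l p + c p l * A l j)) =
  \sum_(k < 3) A j k * \sum_(l < 3) X l * c l k.
Proof.
move=> As H.
have E : \sum_(p < 3) X p * (2^-1 *
    (\sum_(l < 3) A p l * c j l - \sum_(l < 3) A j l * c p l)) = 0.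
  under eq_bigr do rewrite H.
  by rewrite /epsilon !sum3E; move: j; apply: ord3_ind; rewrite /=; field.
rewrite -[RHS]addr0 -[X in _ = _ + X]E !sum3E.
by rewrite !(As _ j) !(As o1 o0) !(As o2 o0) !(As o2 o1); field.
Qed.

(** Dividing by the density r turns the formula of axial_lie for the vector density
r Y into the Lie bracket [X, Y], when r X has divergence 0; dr l stands for
d_l r. *)
Lemma density_lie (r : R) (X Y : 'I_3 -> R) (dX : 'I_3 -> 'I_3 -> R)
    (dY dr : 'I_3 -> R) n : r != 0 ->
  \sum_(l < 3) (r * dX l l + X l * dr l) = 0 ->
  r^-1 * (r * Y n * (\sum_(l < 3) dX l l)
    + \sum_(l < 3) X l * (r * dY l + Y n * dr l)
    - \sum_(l < 3) r * Y l * dX l n) =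
  \sum_(l < 3) X l * dY l - \sum_(l < 3) Y l * dX l n.
Proof.
move=> r0 div0; apply: (mulfI r0); rewrite mulVKf//.
transitivity (Y n * (\sum_(l < 3) (r * dX l l + X l * dr l)) +
  r * (\sum_(l < 3) X l * dY l - \sum_(l < 3) Y l * dX l n)).
  by rewrite !sum3E; ring.
by rewrite div0 mulr0 add0r.
Qed.

Lemma pairing_symm (A B : 'I_3 -> 'I_3 -> R) (X S : 'I_3 -> R) :
  (forall i j, A i j = A j i) ->
  \sum_(k < 3) (\sum_(m < 3) A k m * X m) * (\sum_(p < 3) B k p * S p) =
  \sum_(m < 3) X m * \sum_(k < 3) A m k * (\sum_(p < 3) B k p * S p).
Proof.
move=> As; rewrite !sum3E !(As o1 o0) !(As o2 o0) !(As o2 o1); ring.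
Qed.

End Algebra3.

(** * Exterior derivatives in coordinates *)

Section FlatCalculus.
Variable R : realType.
Implicit Types (x : 'rV[R]_3).
Local Notation o0 := (@Ordinal 3 0 isT).
Local Notation o1 := (@Ordinal 3 1 isT).
Local Notation o2 := (@Ordinal 3 2 isT).

(** The existence at x of all the partial derivatives. *)
Definition derivable_at (f : 'rV[R]_3 -> R) x :=
  forall i, derivable f x (basis_vec R i).

(** Jacobi's formula, for a derivative of A of the form C^T A + A C. *)
Lemma is_derive_det3 (A : 'rV[R]_3 -> 'M[R]_3) (dA : 'I_3 -> 'I_3 -> R)
    (C : 'I_3 -> 'I_3 -> R) x v :
  (forall i j, is_derive x v (fun y => A y i j) (dA i j)) ->
  (forall i j, dA i j =
     \sum_(l < 3) (C l i * A x l j + C l j * A x i l)) ->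
  is_derive x v (fun y => \det (A y)) (2 * \det (A x) * \sum_(i < 3) C i i).
Proof.
move=> Ad dAE.
pose F i j := fun y => A y i j.
have Fd i j : is_derive x v (F i j) (dA i j) by exact: Ad.
rewrite (_ : (fun y => \det (A y)) =
    F o0 o0 * (F o1 o1 * F o2 o2 - F o1 o2 * F o2 o1)
  - F o0 o1 * (F o1 o0 * F o2 o2 - F o1 o2 * F o2 o0)
  + F o0 o2 * (F o1 o0 * F o2 o1 - F o1 o1 * F o2 o0)); last first.
  by apply/funext => y; rewrite det_mx3.
have FE i j : F i j x = A x i j by [].
move: (A x) FE dAE => B FE dAE.
apply: is_derive_eq; rewrite /GRing.scale/= !fctE !FE !dAE det_mx3 !sum3E.
by ring.
Qed.

Lemma partial_contract (W : 'rV[R]_3 -> 'I_3 -> R) x l i j :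
  (forall k, derivable_at (W ^~ k) x) ->
  partial l (fun y => \sum_(k < 3) W y k * epsilon R k i j) x =
  \sum_(k < 3) partial l (W ^~ k) x * epsilon R k i j.
Proof.
move=> Wd; rewrite partial_sum; last first.
  by move=> k; apply: derivableM; [exact: Wd|exact: derivable_cst].
apply: eq_bigr => k _; rewrite partialM; [|exact: Wd|exact: derivable_cst].
by rewrite partial_cst mulr0 add0r mulrC.
Qed.

Lemma d2_contract (W : 'rV[R]_3 -> 'I_3 -> R) x i j k :
  (forall l, derivable_at (W ^~ l) x) ->
  d2 (fun y i j => \sum_(k < 3) W y k * epsilon R k i j) x i j k =
  (\sum_(l < 3) partial l (W ^~ l) x) * epsilon R i j k.
Proof.
move=> Wd; rewrite /d2 !partial_contract//.
exact: (epsilon_trace (fun l k => partial l (W ^~ k) x)).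
Qed.

(** The exterior derivative of i_u i_W (dx^0 dx^1 dx^2) as an axial vector. *)
Lemma axial_d1_contract (u W : 'rV[R]_3 -> 'I_3 -> R) x n :
  (forall l, derivable_at (u ^~ l) x) -> (forall l, derivable_at (W ^~ l) x) ->
  axial (d1 (fun y m =>
    \sum_(i < 3) u y i * \sum_(k < 3) W y k * epsilon R k i m) x) n =
  W x n * (\sum_(l < 3) partial l (u ^~ l) x)
  + \sum_(l < 3) u x l * partial l (W ^~ n) x
  - \sum_(l < 3) W x l * partial l (u ^~ n) x
  - u x n * \sum_(l < 3) partial l (W ^~ l) x.
Proof.
move=> ud Wd.
have dE l m : partial l (fun y =>
    \sum_(i < 3) u y i * \sum_(k < 3) W y k * epsilon R k i m) x =
    \sum_(i < 3) (u x i * (\sum_(k < 3) partial l (W ^~ k) x * epsilon R k i m)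
      + (\sum_(k < 3) W x k * epsilon R k i m) * partial l (u ^~ i) x).
  have cd i : derivable (fun y => \sum_(k < 3) W y k * epsilon R k i m) x
      (basis_vec R l).
    apply: derivable_sumf => k.
    by apply: derivableM; [exact: Wd|exact: derivable_cst].
  rewrite partial_sum; last by move=> i; apply: derivableM => //; exact: ud.
  by apply: eq_bigr => i _; rewrite partialM ?partial_contract//; exact: ud.
rewrite -(axial_lie (u x) (W x) (fun l k => partial l (u ^~ k) x)
  (fun l k => partial l (W ^~ k) x)).
rewrite /axial; congr (_ * _); apply: eq_bigr => i _; apply: eq_bigr => j _.
by rewrite /d1 !dE.
Qed.

(** d d b = 0. *)
Lemma div_axial_d1 U (b : 'rV[R]_3 -> 'I_3 -> R) x : open U -> U x ->
  (forall i, smooth_on U (b ^~ i)) ->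
  \sum_(l < 3) partial l (fun y => axial (d1 b y) l) x = 0.
Proof.
move=> Uo Ux bs.
have dd i j : derivable_at (partial i (b ^~ j)) x.
  by move=> l; apply: smooth_on_derivable Ux; exact: smooth_on_partial.
have d1d i j : derivable_at (fun y => d1 b y i j) x.
  by move=> l; apply: derivableB; exact: dd.
have dE l : partial l (fun y => axial (d1 b y) l) x = 2^-1 *
    \sum_(i < 3) \sum_(j < 3) epsilon R l i j *
      (partial l (partial i (b ^~ j)) x - partial l (partial j (b ^~ i)) x).
  rewrite /axial partialZ; last first.
    do 2 (apply: derivable_sumf => ?).
    by apply: derivableM; [exact: derivable_cst|exact: d1d].
  rewrite partial_sum; last first.
    move=> i; apply: derivable_sumf => ?.
    by apply: derivableM; [exact: derivable_cst|exact: d1d].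
  congr (_ * _); apply: eq_bigr => i _; rewrite partial_sum; last first.
    by move=> j; apply: derivableM; [exact: derivable_cst|exact: d1d].
  by apply: eq_bigr => j _; rewrite partialZ ?partialB//; [exact: dd|exact: dd|exact: d1d].
under eq_bigr do rewrite dE.
apply: (epsilon_symm (q := fun i j k => partial i (partial j (b ^~ k)) x)).
by move=> i j k; exact: partialC Uo (bs k) Ux.
Qed.

End FlatCalculus.

(** * Riemannian geometry in a chart *)

Section ChartGeometry.
Variables (R : realType) (U : set 'rV[R]_3) (g : 'rV[R]_3 -> 'M[R]_3).
Hypothesis Uo : open U.
Hypothesis gsm : forall i j, smooth_on U (fun x => g x i j).
Hypothesis gsym : forall x, U x -> (g x)^T = g x.
Hypothesis gpos : forall x (v : 'rV[R]_3), U x -> v != 0 ->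
  0 < (v *m g x *m v^T) 0 0.
Local Notation o0 := (@Ordinal 3 0 isT).
Local Notation o1 := (@Ordinal 3 1 isT).
Local Notation o2 := (@Ordinal 3 2 isT).
Local Notation Gam := (christoffel g).
Implicit Types (x : 'rV[R]_3) (u v w : 'rV[R]_3 -> 'I_3 -> R).

(** The density rho of the Riemannian volume form. *)
Definition density x : R := Num.sqrt (\det (g x)).

Lemma metric_det_gt0 x : U x -> 0 < \det (g x).
Proof. by move=> Ux; apply: det3_gt0; [exact: gsym|move=> v; exact: gpos]. Qed.

Lemma metric_unit x : U x -> g x \in unitmx.
Proof. by move=> Ux; rewrite unitmxE unitfE gt_eqF// metric_det_gt0. Qed.

Lemma density_gt0 x : U x -> 0 < density x.
Proof. by move=> Ux; rewrite sqrtr_gt0 metric_det_gt0. Qed.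

Lemma density_neq0 x : U x -> density x != 0.
Proof. by move=> Ux; rewrite gt_eqF// density_gt0. Qed.

Lemma density_sqr x : U x -> density x ^+ 2 = \det (g x).
Proof. by move=> Ux; rewrite sqr_sqrtr// ltW// metric_det_gt0. Qed.

Lemma metricC x i j : U x -> g x i j = g x j i.
Proof. by move=> /gsym/matrixP/(_ i j); rewrite mxE. Qed.

Lemma metric_derivable x i j : U x -> derivable_at (fun y => g y i j) x.
Proof. by move=> Ux l; exact: smooth_on_derivable Ux. Qed.

Lemma sharp_flat u x i : U x -> sharp g (flat g u) x i = u x i.
Proof.
move=> Ux; rewrite /sharp /flat.
transitivity (\sum_(k < 3) (\sum_(j < 3) ginv g x i j * g x j k) * u x k).
  by rewrite !sum3E; ring.
rewrite (bigD1 i)//= [X in _ + X]big1 ?addr0.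
  by rewrite ginvVl ?metric_unit// eqxx mul1r.
by move=> k /negPf ki; rewrite ginvVl ?metric_unit// eq_sym ki mul0r.
Qed.

Lemma flat_sharp u x i : U x -> flat g (sharp g u) x i = u x i.
Proof.
move=> Ux; rewrite /sharp /flat.
transitivity (\sum_(k < 3) (\sum_(j < 3) g x i j * ginv g x j k) * u x k).
  by rewrite !sum3E; ring.
rewrite (bigD1 i)//= [X in _ + X]big1 ?addr0.
  by rewrite ginvVr ?metric_unit// eqxx mul1r.
by move=> k /negPf ki; rewrite ginvVr ?metric_unit// eq_sym ki mul0r.
Qed.

Lemma metric_near x : U x -> \forall y \near x, (g y)^T = g y.
Proof.
move=> Ux; near=> y; apply: gsym; near: y; exact: open_nbhs_nbhs.
Unshelve. all: by end_near.
Qed.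

Lemma christoffelC x k i j : U x -> Gam x k i j = Gam x k j i.
Proof.
move=> Ux; have [C _] := levi_civitaP (Gam x) (metric_unit Ux) (metric_near Ux).
by have [+ _] := C (fun _ _ _ => erefl); exact.
Qed.

(** nabla g = 0. *)
Lemma metric_compat x i j k : U x -> partial k (fun y => g y i j) x =
  \sum_(l < 3) (Gam x l k i * g x l j + Gam x l k j * g x i l).
Proof.
move=> Ux; have [C _] := levi_civitaP (Gam x) (metric_unit Ux) (metric_near Ux).
by have [_ +] := C (fun _ _ _ => erefl); exact.
Qed.

(** The star of a 2-form a is the 1-form dual to the vector field axial a / rho. *)
Lemma star2E (a : 'rV[R]_3 -> 'I_3 -> 'I_3 -> R) x k : U x ->
  star2 g a x k = (density x)^-1 * \sum_(l < 3) g x k l * axial (a x) l.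
Proof.
move=> Ux; rewrite /star2 /raise2 /volume_form -/(density x).
have sE : density x * \det (ginv g x) = (density x)^-1.
  rewrite /ginv det_inv -density_sqr// expr2 invfM mulrA divff ?mul1r//.
  exact: density_neq0.
transitivity (2^-1 * density x * \sum_(m < 3) \sum_(n < 3) a x m n *
  \sum_(i < 3) \sum_(j < 3) epsilon R i j k * ginv g x i m * ginv g x j n).
  by rewrite !sum3E; ring.
under eq_bigr do under eq_bigr do
  rewrite (epsilon_mul_inv _ _ _ (mulVmx (metric_unit Ux))).
rewrite -/(ginv g x) -sE /axial.
transitivity (density x * \det (ginv g x) * (2^-1 * \sum_(m < 3) \sum_(n < 3)
  \sum_(l < 3) epsilon R m n l * a x m n * g x l k)).
  by rewrite !sum3E; ring.
by congr (_ * _); rewrite /epsilon !sum3E !(metricC _ k Ux) /=; ring.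
Qed.

(** d_l rho = rho Gamma^i_{i l}. *)
Lemma density_derive x l : U x -> is_derive x (basis_vec R l) density
  (density x * \sum_(i < 3) Gam x i l i).
Proof.
move=> Ux.
have Dd : is_derive x (basis_vec R l) (fun y => \det (g y))
    (2 * \det (g x) * \sum_(i < 3) Gam x i l i).
  apply: (is_derive_det3 (C := fun i j => Gam x i l j)
    (dA := fun i j => partial l (fun y => g y i j) x)) => i j.
    by apply: DeriveDef => //; exact: metric_derivable.
  exact: metric_compat.
set S := \sum_(i < 3) _ in Dd *.
rewrite (_ : density x * S = (2 * density x)^-1 * (2 * \det (g x) * S)).
  exact: (@is_derive_sqrt _ _ (fun y => \det (g y)) _ _ _ (metric_det_gt0 Ux) Dd).
by rewrite -density_sqr//; field; exact: density_neq0.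
Qed.

Lemma density_derivable x : U x -> derivable_at density x.
Proof. by move=> Ux l; have [] := density_derive l Ux. Qed.

(** rho div u is the coordinate divergence of the vector density rho u. *)
Lemma divergence_density u x : U x -> (forall k, derivable_at (u ^~ k) x) ->
  \sum_(l < 3) partial l (fun y => density y * u y l) x =
  density x * divergence g u x.
Proof.
move=> Ux ud.
have E l : partial l (fun y => density y * u y l) x = density x *
    (partial l (u ^~ l) x + u x l * \sum_(i < 3) Gam x i l i).
  rewrite partialM; [|exact: density_derivable|exact: ud].
  rewrite (_ : partial l density x = density x * \sum_(i < 3) Gam x i l i).
    by ring.
  by have [_] := density_derive l Ux.
under eq_bigr do rewrite E.
rewrite -mulr_sumr /divergence /covd; congr (_ * _).
have C i j k : Gam x k i j = Gam x k j i by exact: christoffelC.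
rewrite !big_split/=; congr (_ + _).
move: (Gam x) C (u x) => G C X.
by rewrite !sum3E !(C o1 o0) !(C o2 o0) !(C o2 o1); ring.
Qed.

Lemma partial_flat v x i j : U x -> (forall k, derivable_at (v ^~ k) x) ->
  partial i (fun y => flat g v y j) x = \sum_(k < 3)
   (g x j k * partial i (v ^~ k) x + v x k * partial i (fun y => g y j k) x).
Proof.
move=> Ux vd; rewrite /flat partial_sum.
  by apply: eq_bigr => k _; rewrite partialM//; [exact: metric_derivable|exact: vd].
by move=> k; apply: derivableM; [exact: metric_derivable|exact: vd].
Qed.

Lemma flat_derivable v x j : U x -> (forall k, derivable_at (v ^~ k) x) ->
  derivable_at (fun y => flat g v y j) x.
Proof.
move=> Ux vd l; apply: derivable_sumf => k.
by apply: derivableM; [exact: metric_derivable|exact: vd].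
Qed.

Lemma covd_flat v x i j : U x -> (forall k, derivable_at (v ^~ k) x) ->
  covd_form g (flat g v) x i j = \sum_(k < 3) g x j k * covd g v x i k.
Proof.
move=> Ux vd; rewrite /covd_form partial_flat// /covd /flat.
under eq_bigr do rewrite metric_compat//.
set a := fun k => partial i (v ^~ k) x.
rewrite -[X in X = _]/(\sum_(k < 3) (g x j k * a k + v x k * _) - _) /=.
rewrite -[RHS]/(\sum_(k < 3) g x j k * (a k + _)).
by move: a (g x) (Gam x) (v x) => a G C X; rewrite !sum3E; ring.
Qed.

Lemma flat_smooth v : (forall k, smooth_on U (v ^~ k)) ->
  forall j, smooth_on U (fun y => flat g v y j).
Proof.
move=> vs j; rewrite /flat; apply: smooth_on_sum => // k.
exact: smooth_onM.
Qed.

Lemma covd_form_ext w w' x i j : U x ->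
  (forall y, U y -> forall k, w y k = w' y k) ->
  covd_form g w x i j = covd_form g w' x i j.
Proof.
move=> Ux ww'; rewrite /covd_form; congr (_ - _).
  by apply: (partial_ext _ Uo Ux) => y; rewrite inE => Uy; exact: ww'.
by apply: eq_bigr => k _; rewrite ww'.
Qed.

Lemma d1_antisym (b : 'rV[R]_3 -> 'I_3 -> R) x i j : d1 b x i j = - d1 b x j i.
Proof. by rewrite /d1 opprB. Qed.

(** d(v^b) is twice the antisymmetric part of nabla v, as the connection is
torsion-free. *)
Lemma d1_covd v x i j : U x -> (forall k, derivable_at (v ^~ k) x) ->
  d1 (flat g v) x i j =
  \sum_(l < 3) g x j l * covd g v x i l - \sum_(l < 3) g x i l * covd g v x j l.
Proof.
move=> Ux vd; rewrite -!covd_flat// /covd_form /d1.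
have -> : \sum_(k < 3) Gam x k j i * flat g v x k =
          \sum_(k < 3) Gam x k i j * flat g v x k.
  by apply: eq_bigr => k _; rewrite (christoffelC k j i Ux).
by rewrite opprB addrA addrNK.
Qed.

(** * The vorticity equation in a chart *)

Section Velocity.
Variable u : 'rV[R]_3 -> 'I_3 -> R.
Hypothesis usm : forall k, smooth_on U (u ^~ k).
Local Notation ub := (flat g u).
Local Notation rho := density.

(** The vorticity 2-form d(u^b) as an axial vector density. *)
Definition vort_density y k := axial (d1 ub y) k.

(** The vorticity vector field xi: vol contracted with xi is d(u^b). *)
Definition vort_vec y k := (rho y)^-1 * vort_density y k.

(** |u|^2 / 2. *)
Definition kinetic y := 2^-1 * \sum_(i < 3) u y i * ub y i.

Let ud y k : U y -> derivable_at (u ^~ k) y.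
Proof. by move=> Uy i; exact: smooth_on_derivable (usm k) Uy. Qed.

Let ubs j : smooth_on U (ub ^~ j). Proof. exact: flat_smooth. Qed.

Let ubd y k : U y -> derivable_at (ub ^~ k) y.
Proof. by move=> Uy i; exact: smooth_on_derivable (ubs k) Uy. Qed.

Lemma vort_density_derivable y k : U y -> derivable_at (vort_density ^~ k) y.
Proof.
move=> Uy l; apply: derivableM; first exact: derivable_cst.
apply: derivable_sumf => i; apply: derivable_sumf => j.
apply: derivableM; first exact: derivable_cst.
by apply: derivableB; apply: smooth_on_derivable Uy; apply: smooth_on_partial;
  exact: ubs.
Qed.

Lemma vort_vec_derivable y k : U y -> derivable_at (vort_vec ^~ k) y.
Proof.
move=> Uy l; apply: derivableM; last exact: vort_density_derivable.
by apply: derivableV; [exact: density_neq0|exact: density_derivable].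
Qed.

Lemma vort_densityE y k : U y -> vort_density y k = rho y * vort_vec y k.
Proof. by move=> Uy; rewrite /vort_vec mulVKf// density_neq0. Qed.

Lemma d1_vort y i j :
  d1 ub y i j = \sum_(k < 3) vort_density y k * epsilon R k i j.
Proof. by rewrite axialK// => *; exact: d1_antisym. Qed.

Lemma vorticity_flat y k : U y -> star2 g (d1 ub) y k = flat g vort_vec y k.
Proof.
move=> Uy; rewrite star2E// /flat mulr_sumr; apply: eq_bigr => l _.
by rewrite /vort_vec mulrCA.
Qed.

Lemma kinetic_smooth : smooth_on U kinetic.
Proof.
apply: smooth_onZ => //; apply: smooth_on_sum => // i; exact: smooth_onM.
Qed.

Lemma advection_flat y j : U y -> flat g (nabla g u u) y j =
  \sum_(i < 3) u y i * (\sum_(k < 3) vort_density y k * epsilon R k i j)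
  + partial j kinetic y.
Proof.
move=> Uy.
have dk : partial j kinetic y = 2^-1 *
    \sum_(i < 3) (u y i * partial j (ub ^~ i) y + ub y i * partial j (u ^~ i) y).
  have dm i : derivable (fun z => u z i * ub z i) y (basis_vec R j).
    by apply: derivableM; [exact: ud|exact: ubd].
  rewrite /kinetic partialZ; last exact: derivable_sumf.
  rewrite partial_sum//; congr (_ * _); apply: eq_bigr => i _.
  by rewrite partialM//; [exact: ud|exact: ubd].
under eq_bigr do rewrite -d1_vort.
rewrite dk /d1 /flat /nabla /covd.
apply: (advection_algebra (A := fun i j => g y i j) (G := christoffel g y)
  (X := u y) (dX := fun i k => partial i (u ^~ k) y)
  (b := fun i k => partial i (ub ^~ k) y)).
- by move=> *; exact: metricC.
- by move=> *; exact: christoffelC.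
- move=> i k; have := @covd_flat u y i k Uy (fun l => @ud y l Uy).
  rewrite /covd_form /covd => <-.
  by rewrite addrNK.
Qed.

Lemma kinetic_dd y i j : U y ->
  partial i (partial j kinetic) y = partial j (partial i kinetic) y.
Proof. by move=> Uy; apply: partialC Uo kinetic_smooth Uy. Qed.

Lemma contract_derivable y j : U y -> derivable_at (fun z =>
  \sum_(i < 3) u z i * (\sum_(k < 3) vort_density z k * epsilon R k i j)) y.
Proof.
move=> Uy l; apply: derivable_sumf => i; apply: derivableM; first exact: ud.
apply: derivable_sumf => k; apply: derivableM; last exact: derivable_cst.
exact: vort_density_derivable.
Qed.

Lemma kinetic_partial_derivable y j : U y -> derivable_at (partial j kinetic) y.
Proof.
move=> Uy l; apply: smooth_on_derivable Uy; apply: smooth_on_partial.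
exact: kinetic_smooth.
Qed.

Lemma advection_derivable y j : U y ->
  derivable_at (fun z => flat g (nabla g u u) z j) y.
Proof.
move=> Uy l; apply: (derivable_ext (f := fun z => 
  \sum_(i < 3) u z i * (\sum_(k < 3) vort_density z k * epsilon R k i j)
  + partial j kinetic z) Uo Uy).
  by move=> z; rewrite inE => Uz; rewrite advection_flat.
by apply: derivableD; [exact: contract_derivable|exact: kinetic_partial_derivable].
Qed.

Lemma d1_advection y i j : U y -> d1 (flat g (nabla g u u)) y i j =
  d1 (fun z m =>
    \sum_(i < 3) u z i * (\sum_(k < 3) vort_density z k * epsilon R k i m)) y i j.
Proof.
move=> Uy.
have E a b : partial a (fun z => flat g (nabla g u u) z b) y =
    partial a (fun z => \sum_(i < 3) u z i *
      (\sum_(k < 3) vort_density z k * epsilon R k i b)) y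
    + partial a (partial b kinetic) y.
  rewrite -partialD; [|exact: contract_derivable|exact: kinetic_partial_derivable].
  by apply: (partial_ext _ Uo Uy) => z; rewrite inE => Uz; rewrite advection_flat.
by rewrite /d1 !E (kinetic_dd i j Uy) opprD addrACA subrr addr0.
Qed.

Hypothesis udiv : forall y, U y -> divergence g u y = 0.

Let rhou_div y : U y -> \sum_(l < 3) partial l (fun z => rho z * u z l) y = 0.
Proof.
by move=> Uy; rewrite divergence_density ?udiv ?mulr0// => k; exact: ud.
Qed.

(** The star of d (nabla_u u)^b is dual to the Lie bracket [u, xi]. *)
Lemma star2_d1_advection y k : U y ->
  star2 g (d1 (flat g (nabla g u u))) y k =
  \sum_(n < 3) g y k n *
    (\sum_(l < 3) u y l * partial l (vort_vec ^~ n) y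
     - \sum_(l < 3) vort_vec y l * partial l (u ^~ n) y).
Proof.
move=> Uy; rewrite star2E// mulr_sumr; apply: eq_bigr => n _.
rewrite mulrCA; congr (_ * _).
have -> : axial (d1 (flat g (nabla g u u)) y) n = axial (d1 (fun z m =>
    \sum_(i < 3) u z i * (\sum_(k < 3) vort_density z k * epsilon R k i m)) y) n.
  rewrite /axial; congr (_ * _); apply: eq_bigr => i _; apply: eq_bigr => j _.
  by rewrite d1_advection.
rewrite axial_d1_contract; last 2 first.
- by move=> l; exact: ud.
- by move=> l; exact: vort_density_derivable.
rewrite (div_axial_d1 Uo Uy ubs) mulr0 subr0.
have dW l : partial l (vort_density ^~ n) y =
    rho y * partial l (vort_vec ^~ n) y + vort_vec y n * partial l rho y.
  rewrite -partialM; [|exact: density_derivable|exact: vort_vec_derivable].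
  apply: (partial_ext _ Uo Uy) => z; rewrite inE => Uz; exact: vort_densityE.
under [X in _ + X - _]eq_bigr do rewrite dW.
under [X in _ - X]eq_bigr do rewrite (vort_densityE _ Uy).
rewrite vort_densityE//.
have S0 : \sum_(l < 3) (rho y * partial l (u ^~ l) y + u y l * partial l rho y) = 0.
  rewrite -[RHS](rhou_div Uy); apply: eq_bigr => l _.
  by rewrite partialM//; [exact: density_derivable|exact: ud].
exact: (@density_lie R (rho y) (u y) (vort_vec y)
  (fun l k => partial l (u ^~ k) y) (fun l => partial l (vort_vec ^~ n) y)
  (fun l => partial l rho y) n (density_neq0 Uy) S0).
Qed.

(** A 1-form whose star is the contraction of dx^0 dx^1 dx^2 with a divergence-free
vector density is coclosed. *)
Lemma codiff1_eq0 (b V : 'rV[R]_3 -> 'I_3 -> R) y : U y ->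
  (forall z, U z -> forall i j,
     star1 g b z i j = \sum_(k < 3) V z k * epsilon R k i j) ->
  (forall k, derivable_at (V ^~ k) y) ->
  \sum_(l < 3) partial l (V ^~ l) y = 0 -> codiff1 g b y = 0.
Proof.
move=> Uy bE Vd V0.
have d0 i j k : d2 (star1 g b) y i j k = 0.
  rewrite -[RHS](mul0r (epsilon R i j k)) -V0 -d2_contract// /d2.
  by congr (_ + _ + _); apply: (partial_ext _ Uo Uy) => z; rewrite inE => Uz;
    exact: bE.
have r0 i j k : raise3 g (d2 (star1 g b)) y i j k = 0.
  rewrite /raise3; do 3 (apply: big1 => ? _).
  by rewrite d0 mulr0.
rewrite /codiff1 /star3 big1 ?mulr0 ?oppr0// => i _.
by rewrite big1// => j _; rewrite big1// => k _; rewrite r0 mul0r.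
Qed.

Lemma star1E (b : 'rV[R]_3 -> 'I_3 -> R) z i j :
  star1 g b z i j = \sum_(k < 3) (rho z * sharp g b z k) * epsilon R k i j.
Proof.
rewrite /star1 /volume_form; apply: eq_bigr => k _.
by rewrite mulrA [_ * Num.sqrt _]mulrC.
Qed.

Lemma codiff1_velocity y : U y -> codiff1 g ub y = 0.
Proof.
move=> Uy; apply: (@codiff1_eq0 _ (fun z k => rho z * u z k)) => //.
- move=> z Uz i j; rewrite star1E; apply: eq_bigr => k _.
  by rewrite sharp_flat.
- move=> k l; apply: derivableM; first exact: density_derivable.
  exact: ud.
- exact: rhou_div.
Qed.

Lemma codiff1_vorticity y : U y -> codiff1 g (star2 g (d1 ub)) y = 0.
Proof.
move=> Uy; apply: (@codiff1_eq0 _ vort_density) => //.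
- move=> z Uz i j; rewrite star1E; apply: eq_bigr => k _.
  rewrite vort_densityE// -(sharp_flat vort_vec k Uz); congr (_ * _ * _).
  by apply: eq_bigr => l _; rewrite vorticity_flat.
- by move=> k; exact: vort_density_derivable.
- exact: (div_axial_d1 Uo Uy ubs).
Qed.

Lemma nabla_vorticity y j : U y ->
  nabla_form g u (star2 g (d1 ub)) y j =
  \sum_(i < 3) u y i * \sum_(k < 3) g y j k * covd g vort_vec y i k.
Proof.
move=> Uy; apply: eq_bigr => i _; congr (_ * _).
rewrite (covd_form_ext (w' := flat g vort_vec))//; last first.
  by move=> z Uz k; exact: vorticity_flat.
by rewrite covd_flat// => k; exact: vort_vec_derivable.
Qed.

Lemma vorticity_transport y j : U y ->
  nabla_form g u (star2 g (d1 ub)) y j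
    - star2 g (d1 (flat g (nabla g u u))) y j =
  flat g (nabla g vort_vec u) y j.
Proof.
move=> Uy; rewrite nabla_vorticity// star2_d1_advection// /flat /nabla /covd.
apply: (bracket_algebra (fun i j => g y i j) (u y) (vort_vec y)
  (fun i k => partial i (u ^~ k) y) (fun i k => partial i (vort_vec ^~ k) y)).
by move=> *; exact: christoffelC.
Qed.

Lemma vortex_stretching y j : U y ->
  comp_form (star2 g (d1 ub)) (nabla_sym g u) y j =
  flat g (nabla g vort_vec u) y j.
Proof.
move=> Uy; rewrite /comp_form /nabla_sym.
pose S p := 2^-1 * \sum_(l < 3) (covd g u y j l * g y l p + covd g u y p l * g y l j).
transitivity (\sum_(p < 3) vort_vec y p * S p).
  transitivity (\sum_(m < 3) vort_vec y m *
      flat g (sharp g (fun _ => S)) y m).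
    under eq_bigr do rewrite (vorticity_flat _ Uy).
    have gC i k : g y i k = g y k i by exact: metricC.
    exact: (pairing_symm (fun k p => ginv g y k p) (vort_vec y) S gC).
  by apply: eq_bigr => m _; rewrite flat_sharp.
apply: (stretching_algebra (A := fun i j => g y i j) (r := rho y)).
  by move=> *; exact: metricC.
move=> i p; rewrite -d1_covd//; last by move=> k; exact: ud.
rewrite d1_vort mulr_sumr; apply: eq_bigr => k _.
by rewrite vort_densityE// mulrA.
Qed.

Variables (D : 'rV[R]_3 -> 'I_3 -> R) (P : 'rV[R]_3 -> R) (nu : R).
Hypothesis nu0 : nu != 0.
Hypothesis Dsm : forall k, smooth_on U (D ^~ k).
Hypothesis Psm : smooth_on U P.
Hypothesis NS : forall y, U y -> forall i,
  D y i + nabla g u u y i + nu * box g u y i = - gradient g P y i.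

(** The lowered momentum equation, solved for d^* d u^b; d d^* u^b vanishes because
u is divergence-free throughout U. *)
Lemma momentum_flat y j : U y -> codiff2 g (d1 ub) y j =
  - nu^-1 * (flat g D y j + flat g (nabla g u u) y j + partial j P y).
Proof.
move=> Uy.
have d00 : d0 (codiff1 g ub) y j = 0.
  rewrite /d0 -[RHS](partial_cst 0 j y); apply: (partial_ext _ Uo Uy) => z.
  by rewrite inE => Uz; exact: codiff1_velocity.
have bE : flat g (box g u) y j = codiff2 g (d1 ub) y j.
  by rewrite /box flat_sharp// /box_form d00 add0r.
have gE : flat g (gradient g P) y j = partial j P y.
  exact: (flat_sharp (fun y i => partial i P y)).
have : \sum_(i < 3) g y j i * (D y i + nabla g u u y i + nu * box g u y i) =
       \sum_(i < 3) g y j i * (- gradient g P y i).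
  by apply: eq_bigr => i _; rewrite NS.
rewrite -bE -gE /flat.
move: (box g u y) (nabla g u u y) (gradient g P y) => B N G.
move=> H; apply: (mulfI nu0); rewrite mulrA mulrN divff// mulN1r.
have -> : nu * \sum_(k < 3) g y j k * B k =
    \sum_(i < 3) g y j i * (D y i + N i + nu * B i)
    - \sum_(i < 3) g y j i * D y i - \sum_(i < 3) g y j i * N i.
  by rewrite !sum3E; ring.
by rewrite H !sum3E; ring.
Qed.

Lemma viscous_vorticity y j : U y -> nu * box_form g (star2 g (d1 ub)) y j =
  - (star2 g (d1 (flat g D)) y j + star2 g (d1 (flat g (nabla g u u))) y j).
Proof.
move=> Uy.
have d00 : d0 (codiff1 g (star2 g (d1 ub))) y j = 0.
  rewrite /d0 -[RHS](partial_cst 0 j y); apply: (partial_ext _ Uo Uy) => z.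
  by rewrite inE => Uz; exact: codiff1_vorticity.
have d1E a b : d1 (codiff2 g (d1 ub)) y a b =
    - nu^-1 * (d1 (flat g D) y a b + d1 (flat g (nabla g u u)) y a b).
  have pE k l : partial k (fun z => codiff2 g (d1 ub) z l) y =
      - nu^-1 * (partial k (fun z => flat g D z l) y
      + partial k (fun z => flat g (nabla g u u) z l) y
      + partial k (partial l P) y).
    have dD : derivable_at (fun z => flat g D z l) y.
      by apply: flat_derivable => // m i; exact: smooth_on_derivable (Dsm m) Uy.
    have dN := @advection_derivable y l Uy.
    have dP : derivable_at (partial l P) y.
      by move=> i; exact: smooth_on_derivable (smooth_on_partial _ Psm) Uy.
    rewrite -partialD; [|exact: dD|exact: dN].
    rewrite -partialD; [|by apply: derivableD; [exact: dD|exact: dN]|exact: dP].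
    rewrite -partialZ; last first.
      apply: derivableD; last exact: dP.
      by apply: derivableD; [exact: dD|exact: dN].
    by apply: (partial_ext _ Uo Uy) => z; rewrite inE => Uz; exact: momentum_flat.
  rewrite /d1 !pE (partialC a b Uo Psm Uy); ring.
rewrite /box_form d00 add0r.
(* By definition d^* d omega = * d * d omega, and * d omega = d^* d u^b. *)
rewrite -[codiff2 g _ y j]/(star2 g (d1 (codiff2 g (d1 ub))) y j).
rewrite !star2E//.
have aE l : axial (d1 (codiff2 g (d1 ub)) y) l = - nu^-1 *
    (axial (d1 (flat g D) y) l + axial (d1 (flat g (nabla g u u)) y) l).
  rewrite /axial; under eq_bigr do under eq_bigr do rewrite d1E.
  move: (d1 (flat g D) y) (d1 (flat g (nabla g u u)) y) => a b.
  by rewrite !sum3E; ring.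
under eq_bigr do rewrite aE.
move: (fun l => axial (d1 (flat g D) y) l)
  (fun l => axial (d1 (flat g (nabla g u u)) y) l) (density_neq0 Uy) => a b r0.
by rewrite !sum3E; field; rewrite nu0 r0.
Qed.

Lemma vorticity_equation y j : U y ->
  star2 g (d1 (flat g D)) y j + nabla_form g u (star2 g (d1 ub)) y j
    + nu * box_form g (star2 g (d1 ub)) y j
  = comp_form (star2 g (d1 ub)) (nabla_sym g u) y j.
Proof.
move=> Uy; rewrite viscous_vorticity// vortex_stretching// -vorticity_transport//.
by rewrite [X in X + _]addrC opprD addrA addrK.
Qed.

End Velocity.

End ChartGeometry.

(** * Vorticity of a time-dependent velocity *)

(** The vorticity of the time derivative of v is the time derivative of its
vorticity: both are the same linear expression, with coefficients that do not
depend on time, in v, its partial derivatives and their time derivatives. *)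
Lemma dt_star2_d1_flat (R : realType) (J : set R) (U : set 'rV[R]_3)
    (g : 'rV[R]_3 -> 'M[R]_3) (v : R -> 'rV[R]_3 -> 'I_3 -> R) t x k :
  is_interval J -> (exists a b, [/\ J a, J b & a < b]) -> open U ->
  (forall i j, smooth_on U (fun y => g y i j)) ->
  (forall i, time_smooth_on J U (fun s y => v s y i)) -> J t -> U x ->
  dt J (fun s => star2 g (d1 (flat g (v s))) x k) t =
  star2 g (d1 (flat g (fun y i => dt J (fun s => v s y i) t))) x k.
Proof.
move=> Ji Jn Uo gs vs Jt Ux.
have gd i j : derivable_at (fun y => g y i j) x.
  by move=> l; exact: smooth_on_derivable Ux.
pose D y i := dt J (fun s => v s y i) t.
have pfE w i j : (forall m, derivable_at (w ^~ m) x) ->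
    partial i (fun y => flat g w y j) x = \sum_(m < 3)
      (g x j m * partial i (w ^~ m) x + partial i (fun y => g y j m) x * w x m).
  move=> wd; rewrite /flat partial_sum; last first.
    by move=> m; apply: derivableM; [exact: gd|exact: wd].
  apply: eq_bigr => m _; rewrite partialM; [|exact: gd|exact: wd].
  by rewrite [w x m * _]mulrC.
have vd s m : J s -> derivable_at (fun y => v s y m) x.
  by move=> Js l; exact: smooth_on_derivable (time_smooth_smooth (vs m) Js) Ux.
have Dd m : derivable_at (D ^~ m) x.
  move=> l; apply: smooth_on_derivable Ux.
  exact: (time_smooth_smooth (time_smooth_dt (vs m)) Jt).
(* The derivative d_i of the j-th component of (v s)^b, by the product rule. *)
pose pf i j s := \sum_(m < 3)
  (g x j m * partial i (fun y => v s y m) x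
   + partial i (fun y => g y j m) x * v s x m).
have pf_dt i j : has_dt J (pf i j) t (partial i (fun y => flat g D y j) x).
  rewrite pfE//; apply: has_dt_sum => m; apply: has_dtD; apply: has_dtM.
    rewrite /D -(dt_partialC Ji Jn i Uo (vs m) Jt Ux); apply: dt_derivableP.
    exact: (time_smooth_dt_derivable (time_smooth_partial i (vs m)) Jt Ux).
  exact: dt_derivableP (time_smooth_dt_derivable (vs m) Jt Ux).
have d1_dt i j : has_dt J (fun s => pf i j s - pf j i s) t (d1 (flat g D) x i j).
  rewrite /d1 -[X in has_dt _ _ _ (_ + X)]mulN1r.
  rewrite (_ : (fun s => _) = fun s => pf i j s + -1 * pf j i s).
    by apply: has_dtD; [exact: pf_dt|apply: has_dtM; exact: pf_dt].
  by apply/funext => s; rewrite mulN1r.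
have fE : {in J, forall s, star2 g (d1 (flat g (v s))) x k =
    2^-1 * \sum_(i < 3) \sum_(j < 3) volume_form g x i j k *
      \sum_(a < 3) \sum_(b < 3) ginv g x i a * ginv g x j b *
        (pf a b s - pf b a s)}.
  move=> s; rewrite inE => Js; rewrite /star2; congr (_ * _).
  apply: eq_bigr => i _; apply: eq_bigr => j _; rewrite mulrC /raise2.
  congr (_ * _); apply: eq_bigr => a _; apply: eq_bigr => b _.
  have pE i' j' : partial i' (fun y => flat g (v s) y j') x = pf i' j' s.
    by apply: pfE => m; exact: vd.
  by rewrite /d1 !pE.
apply: has_dtE => //; apply: has_dt_ext Jt fE _.
rewrite [X in has_dt _ _ _ X](_ : _ =
    2^-1 * \sum_(i < 3) \sum_(j < 3) volume_form g x i j k *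
      \sum_(a < 3) \sum_(b < 3) ginv g x i a * ginv g x j b *
        d1 (flat g D) x a b); last first.
  rewrite /star2; congr (_ * _).
  by apply: eq_bigr => i _; apply: eq_bigr => j _; rewrite mulrC.
apply: has_dtM; do 2 (apply: has_dt_sum => ?); apply: has_dtM.
by do 2 (apply: has_dt_sum => ?); apply: has_dtM.
Qed.

Theorem corollary2p5 (R : realType) (M : oriented_manifold R 3)
    (g : riemannian_metric M) (nu : R) (J : set R)
    (u : R -> atlas M -> 'rV[R]_3 -> 'I_3 -> R) (p : R -> M -> R) :
  geodesically_complete g ->
  0 < nu ->
  is_interval J -> (exists a b, [/\ J a, J b & a < b]) ->
  time_smooth_vector_field J u ->
  (forall t, J t -> smooth_function (p t)) ->
  (forall t, J t -> forall c x, chart_image c x ->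
     (forall i,
        dt J (fun s => u s c x i) t + nabla (g c) (u t c) (u t c) x i
          + nu * box (g c) (u t c) x i
        = - gradient (g c) (p t \o chart_inv c) x i) /\
     divergence (g c) (u t c) x = 0) ->
  let vorticity2 t c := d1 (flat (g c) (u t c)) in
  let omega t c := star2 (g c) (vorticity2 t c) in
  forall t, J t -> forall c x, chart_image c x -> forall i,
    dt J (fun s => omega s c x i) t + nabla_form (g c) (u t c) (omega t c) x i
      + nu * box_form (g c) (omega t c) x i
    = comp_form (omega t c) (nabla_sym (g c) (u t c)) x i.
Proof.
move=> _ nu0 Ji Jn [_ us] ps NS vorticity2 omega t Jt c x Ux i.
have Uo : open (chart_image c) by exact: chart_image_open.
have gs := metric_smooth g c.
rewrite /omega /vorticity2 (dt_star2_d1_flat i Ji Jn Uo gs (us c) Jt Ux).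
have gsym x' : chart_image c x' -> (g c x')^T = g c x'.
  exact: (@Defs.metric_sym _ _ _ g c x').
have usm k : smooth_on (chart_image c) (fun y => u t c y k).
  exact: time_smooth_smooth (us c k) Jt.
have Dsm k : smooth_on (chart_image c) (fun y => dt J (fun s => u s c y k) t).
  exact: (time_smooth_smooth (time_smooth_dt (us c k)) Jt).
have div0 y : chart_image c y -> divergence (g c) (u t c) y = 0.
  by move=> Uy; have [] := NS t Jt c y Uy.
have momentum y : chart_image c y -> forall k,
    dt J (fun s => u s c y k) t + nabla (g c) (u t c) (u t c) y k
      + nu * box (g c) (u t c) y k = - gradient (g c) (p t \o chart_inv c) y k.
  by move=> Uy; have [] := NS t Jt c y Uy.
exact: (vorticity_equation Uo gs gsym (@Defs.metric_pos _ _ _ g c) usm div0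
  (lt0r_neq0 nu0) Dsm (ps t Jt c) momentum).
Qed.
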